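(* A Banach space $X$ has trivial Rademacher type if and only if $$\sup_{n\in\mathbb{N}} c_X\big(Sym_n,d_{\{t,c\}}\big)<\infty .$$
   Context: $Sym_n$ is the group of permutations of $\mathbb{Z}/n=\{0,\ldots,n-1\}$, $t=(0\,1)$, $c=(0\,1\,2\ldots n-1)$ (both the identity if $n=1$). The word metric $d_{\{t,c\}}$ is the shortest path metric on the Cayley graph with vertex set $Sym_n$ and undirected edges joining $\pi$ to $t\pi$ and to $c\pi$ for all $\pi\in Sym_n$. For a Banach space $X$ and a metric space $(M,d)$, $c_X(M,d)$ is the infimum of all $D> 1$ for which there is a map $f:M\to X$ with $d(x,y)\le\|f(x)-f(y)\|_X\le D\,d(x,y)$ for all $x,y\in M$ (and $c_X(M,d)=\infty$ if there is no such $D$). A Banach space $X$ has Rademacher type $p\in[1,2]$ if there is $T<\infty$ such that for all $m$ and $x_1,\ldots,x_m\in X$, $\mathbb{E}\|\sum_i \varepsilon_i x_i\|^p\le T^p\sum_i\|x_i\|^p$, where $\varepsilon_1,\dots,\varepsilon_m$ are independent uniform random signs. $X$ has trivial Rademacher type if it does not have type $p$ for any $p>1$. *)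

(* Defs.v *)
From HB Require Import structures.
From mathcomp Require Import all_boot all_order all_algebra all_fingroup.
From mathcomp Require Import all_classical all_reals all_analysis.

Set Implicit Arguments.
Unset Strict Implicit.
Unset Printing Implicit Defensive.

Import Order.TTheory GRing.Theory Num.Theory.
Import numFieldNormedType.Exports.

Local Open Scope ring_scope.

(* Everything about symmetric groups is indexed by n.+1, so that n : nat ranges
   over the nonempty index sets {0, ..., n}. *)

(* The transposition (0 1); since [ordS] is addition of 1 modulo n.+1, it is
   the identity for n.+1 = 1. *)
Definition tgen (n : nat) : 'S_n.+1 := tperm ord0 (ordS ord0).

(* The cycle (0 1 ... n), i |-> i + 1 modulo n.+1. *)
Definition cgen (n : nat) : 'S_n.+1 := perm (@ordS_inj n.+1).

(* MathComp composes permutations from left to right, (s * t) i = t (s i), so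
   the composition of functions "t o p" is written p * t. *)
Definition cayley_edge (n : nat) : rel 'S_n.+1 := fun p q =>
  [|| q == (p * tgen n)%g, q == (p * cgen n)%g,
      p == (q * tgen n)%g | p == (q * cgen n)%g].

Definition cayley_walk (n : nat) (p q : 'S_n.+1) (k : nat) : bool :=
  [exists s : k.-tuple 'S_n.+1,
     path (@cayley_edge n) p s && (last p s == q)].

Lemma cayley_walkP (n : nat) (p q : 'S_n.+1) (k : nat) :
  reflect (exists s, [/\ path (@cayley_edge n) p s, last p s = q & size s = k])
          (cayley_walk p q k).
Proof.
apply: (iffP existsP) => [[s /andP[ps /eqP ls]]|[s [ps ls sk]]].
  by exists s; rewrite size_tuple.
by exists (Tuple (introT eqP sk)) => /=; rewrite ps ls eqxx.
Qed.

Lemma cayley_edge_sym (n : nat) : symmetric (@cayley_edge n).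
Proof.
by move=> p q; rewrite /cayley_edge; do 4 case: (_ == _).
Qed.

Lemma gen_tgen_cgen (n : nat) : <<[set tgen n; cgen n]>>%g = [set: 'S_n.+1].
Proof.
case: n => [|n].
  apply/setP => s; rewrite inE; have -> : s = 1%g; last exact: group1.
  by apply/permP => i; rewrite !ord1.
have -> : cgen n.+1 = perm (addrI (1 : 'I_n.+2)).
  apply/permP => i; rewrite !permE.
  by apply: val_inj; rewrite /= add1n.
apply: (@gen_tpermn_circular_shift n ord0 (ordS ord0)).
by rewrite subr0 /= modn_small // coprimen1.
Qed.

Lemma cayley_connected (n : nat) (p q : 'S_n.+1) : exists k, cayley_walk p q k.
Proof.
have /gen_prodgP[m [g gS e]] : (p^-1 * q)%g \in <<[set tgen n; cgen n]>>%g.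
  by rewrite gen_tgen_cgen inE.
have -> : q = (p * \prod_(i < m) g i)%g by rewrite -e mulKVg.
exists m; elim: m g gS {q e} => [|m IH] g gS.
  by apply/cayley_walkP; exists [::]; rewrite big_ord0 mulg1.
have /cayley_walkP[s [ps ls sm]] := IH (fun i => g (widen_ord (leqnSn m) i))
  (fun i => gS _).
apply/cayley_walkP; exists (rcons s (p * \prod_(i < m.+1) g i)%g).
rewrite last_rcons size_rcons sm; split=> //.
rewrite rcons_path ps ls big_ord_recr mulgA /cayley_edge.
by have /set2P[->|->] := gS ord_max; rewrite eqxx ?orbT.
Qed.

(* The shortest path metric of the Cayley graph. *)
Definition word_dist (n : nat) (p q : 'S_n.+1) : nat :=
  ex_minn (cayley_connected p q).

Lemma word_dist_walk (n : nat) (p q : 'S_n.+1) :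
  cayley_walk p q (word_dist p q).
Proof. by rewrite /word_dist; case: ex_minnP. Qed.

Lemma word_dist_le (n : nat) (p q : 'S_n.+1) (k : nat) :
  cayley_walk p q k -> (word_dist p q <= k)%N.
Proof. by rewrite /word_dist; case: ex_minnP => m _; apply. Qed.

Lemma word_distxx (n : nat) (p : 'S_n.+1) : word_dist p p = 0%N.
Proof.
apply/eqP; rewrite -leqn0; apply/word_dist_le/cayley_walkP.
by exists [::].
Qed.

Lemma word_dist_eq0 (n : nat) (p q : 'S_n.+1) : word_dist p q = 0%N -> p = q.
Proof.
move=> d0; have := word_dist_walk p q; rewrite d0.
by move=> /cayley_walkP[s [_ <- /size0nil ->]].
Qed.

Lemma word_dist_sym (n : nat) (p q : 'S_n.+1) : word_dist p q = word_dist q p.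
Proof.
suff le (a b : 'S_n.+1) : (word_dist a b <= word_dist b a)%N.
  by apply/eqP; rewrite eqn_leq !le.
have /cayley_walkP[s [ps ls <-]] := word_dist_walk b a.
apply/word_dist_le/cayley_walkP; exists (rev (belast b s)).
split; last by rewrite size_rev size_belast.
- rewrite -ls rev_path (eq_path (e' := @cayley_edge n)) // => x y.
  exact: cayley_edge_sym.
- by case: s ps ls => [|x s] //= _ _; rewrite rev_cons last_rcons.
Qed.

Lemma word_dist_triangle (n : nat) (q p r : 'S_n.+1) :
  (word_dist p r <= word_dist p q + word_dist q r)%N.
Proof.
have /cayley_walkP[s [ps ls <-]] := word_dist_walk p q.
have /cayley_walkP[s' [ps' ls' <-]] := word_dist_walk q r.
apply/word_dist_le/cayley_walkP; exists (s ++ s').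
by rewrite cat_path last_cat size_cat ps ls ps' ls'.
Qed.

(* [SymS R n] is the metric space (Sym_(n+1), d_{t,c}). *)
Definition SymS (R : realType) (n : nat) : Type := 'S_n.+1.

HB.instance Definition _ (R : realType) (n : nat) := Choice.on (SymS R n).

Section SymS_metric.
Context (R : realType) (n : nat).

Let d (p q : SymS R n) : R := (word_dist p q)%:R.

Let dxx p : d p p = 0. Proof. by rewrite /d word_distxx. Qed.

Let d_eq0 p q : d p q = 0 -> p = q.
Proof. by move/eqP; rewrite pnatr_eq0 => /eqP/word_dist_eq0. Qed.

Let d_sym p q : d p q = d q p. Proof. by rewrite /d word_dist_sym. Qed.

Let d_triangle q p r : d p r <= d p q + d q r.
Proof. by rewrite /d -natrD ler_nat word_dist_triangle. Qed.

HB.instance Definition _ := isMetric.Build R (SymS R n) dxx d_eq0 d_sym d_triangle.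
End SymS_metric.

Lemma mdist_SymS (R : realType) (n : nat) (p q : SymS R n) :
  mdist p q = (word_dist p q)%:R.
Proof. by []. Qed.

Local Open Scope classical_set_scope.

(* c_X(M); the infimum of the empty set is +oo. *)
Definition distortion (R : realType) (X : normedModType R) (M : metricType R) :
    \bar R :=
  ereal_inf [set D%:E | D in [set D : R | 1 < D /\
    exists f : M -> X, forall x y : M,
      mdist x y <= `|f x - f y| <= D * mdist x y]].

(* The expectation over m independent uniform random signs is the average over
   the 2 ^ m sign vectors, encoded by eps : 'I_m -> bool with sign
   (-1) ^+ eps i. *)
Definition rademacher_mean (R : realType) (X : normedModType R) (p : R)
    (m : nat) (x : 'I_m -> X) : R :=
  (2 ^+ m)^-1 * \sum_(eps : {ffun 'I_m -> bool})
    `|\sum_(i < m) (-1) ^+ eps i *: x i| `^ p.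

Definition rademacher_type (R : realType) (X : normedModType R) (p : R) : Prop :=
  1 <= p <= 2 /\
  exists2 T : R, 0 <= T & forall (m : nat) (x : 'I_m -> X),
    rademacher_mean p x <= T `^ p * \sum_(i < m) `|x i| `^ p.

Definition trivial_rademacher_type (R : realType) (X : normedModType R) : Prop :=
  forall p : R, 1 < p -> ~ rademacher_type X p.

(* Main.v *)
Require Import Defs.
From mathcomp Require Import all_boot all_order all_algebra all_fingroup.
From mathcomp Require Import all_classical all_reals all_analysis.
From mathcomp Require Import zify ring lra.

(* If X has trivial type, it contains copies of every l_1^k with distortion 2
   (Pisier), so it suffices to embed Sym_n into l_1. The embedding records
   (a) the differences p i - p j mod n for all pairs of labels, a measure of the
   total displacement, and (b) the words read along the arcs that avoid the
   cursor, a lamplighter-type measure of the travel of the cursor; gnome sort on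
   the complement of a long common arc shows that these two quantities control
   the word metric.

   Conversely, exchanging j and j + m for arbitrary sets of j < m embeds the cube
   {0,1}^m into Sym_(4m+1): edges have length O(m), while antipodal points are
   at distance at least m^2/40, by (a). If X has type p > 1, differentiating the
   noise operator and symmetrizing gives Pisier's inequality, which bounds the
   distance of some antipodal pair by O(m^(1/p) log m) times the maximal length
   of an edge. *)

Set Implicit Arguments.
Unset Strict Implicit.
Unset Printing Implicit Defensive.

Import Order.TTheory GRing.Theory Num.Theory.
Import numFieldNormedType.Exports.

Local Open Scope nat_scope.

(** * Sorting with a cursor *)

(** Neither half of the embedding suffices alone. Displacement has to be measured up to rotation,
    because [c] moves every label; the price is an additive error of the order of N = n + 1, the
    cost of a rotation. The words remove it: if about M N of them disagree, then either M is
    comparable to N and the disagreement itself pays for a rotation, or the arrangements share, up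
    to a shift, an arc missing only O(M) locations, and only its complement has to be sorted. The
    scalings N^2 and N in the embedding are the orders of the change that one generator can cause in
    the two quantities. In the converse, antipodal points are farther apart than edges by a factor
    of order m, as in l_1^m, and type p cannot allow this. The logarithm arises because the
    derivative of the noise operator is only bounded by a multiple of 1/s, which is integrated from
    about 1/m to 1/2; it is harmless since p > 1. Copies of l_1^k come from a dichotomy: without a
    copy of l_1^N, random sums of N vectors beat the triangle inequality by a fixed factor, and
    passing to N^k vectors raises this gain to the k-th power, which yields a type p > 1. *)

Section WordMetric.
Context (n : nat).
Local Notation N := n.+1.
Implicit Types (p q g : 'S_N).

Lemma cayley_edgeMl g p q : cayley_edge (g * p)%g (g * q)%g = cayley_edge p q.
Proof. by rewrite /cayley_edge -!mulgA !(inj_eq (mulgI g)). Qed.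

Lemma word_distMl g p q : word_dist (g * p)%g (g * q)%g = word_dist p q.
Proof.
have le (h a b : 'S_N) : word_dist (h * a)%g (h * b)%g <= word_dist a b.
  have /cayley_walkP[s [ps ls <-]] := word_dist_walk a b.
  apply/word_dist_le/cayley_walkP; exists (map (mulg h) s).
  rewrite size_map last_map ls; split=> //.
  elim: s a ps {ls} => [|x s IH] a //= /andP[e ps].
  by rewrite cayley_edgeMl e IH.
apply/eqP; rewrite eqn_leq le /=.
by have := le g^-1%g (g * p)%g (g * q)%g; rewrite !mulKg.
Qed.

Lemma word_dist1 p q : word_dist p q = word_dist 1%g (p^-1 * q)%g.
Proof. by rewrite -[RHS](word_distMl p) mulg1 mulKVg. Qed.

Lemma word_dist_edge p q : cayley_edge p q -> word_dist p q <= 1.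
Proof.
move=> e; apply/word_dist_le/cayley_walkP; exists [:: q].
by rewrite /= e.
Qed.

Lemma word_distMt p : word_dist p (p * tgen n)%g <= 1.
Proof. by apply: word_dist_edge; rewrite /cayley_edge eqxx. Qed.

Lemma word_distMcX p k : word_dist p (p * cgen n ^+ k)%g <= k.
Proof.
elim: k => [|k IH]; first by rewrite expg0 mulg1 word_distxx.
apply: leq_trans (word_dist_triangle (p * cgen n ^+ k)%g _ _) _.
rewrite -[leqRHS]addn1 leq_add //; apply: word_dist_edge.
by rewrite /cayley_edge expgSr mulgA eqxx orbT.
Qed.

Lemma word_dist1M g p : word_dist 1%g (g * p)%g <= word_dist 1%g g + word_dist 1%g p.
Proof.
apply: leq_trans (word_dist_triangle g _ _) _.
by rewrite leq_add2l -{1}(mulg1 g) word_distMl.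
Qed.

Lemma val_cgenX k (i : 'I_N) : (cgen n ^+ k)%g i = (i + k) %% N :> nat.
Proof.
elim: k => [|k IH]; first by rewrite expg0 perm1 addn0 modn_small.
by rewrite expgSr permM permE /= IH addnS -[(_ %% _).+1]addn1 modnDml addn1.
Qed.

Lemma tgen_cgenX k (i j : 'I_N) : i = k :> nat -> j = k.+1 :> nat ->
  (cgen n ^- k * tgen n * cgen n ^+ k)%g = tperm i j.
Proof.
move=> ik jk; have -> : (cgen n ^- k * tgen n * cgen n ^+ k)%g =
  (tgen n ^ (cgen n ^+ k))%g by rewrite /conjg mulgA.
have n0 : 0 < n by have := ltn_ord j; lia.
rewrite /tgen tpermJ; congr (tperm _ _); apply/val_inj => /=.
  by rewrite val_cgenX ik add0n modn_small // -ik.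
by rewrite val_cgenX /= modnDml jk modn_small ?add1n // -jk.
Qed.

Definition inversions g : nat :=
  \sum_(i < N) \sum_(j < N) ((i < j) && (g j < g i)).

(** Reindexing pairs by the transposition compares the two counts term by term: apart from [i] and
    [j] themselves, exchanging neighbours preserves the order of any two locations. *)
Lemma inversions_swap g (i j : 'I_N) : j = i.+1 :> nat -> g j < g i ->
  inversions (tperm i j * g)%g < inversions g.
Proof.
move=> ji gji; rewrite /inversions !pair_big /=.
have inj2 : injective (fun x : 'I_N * 'I_N => (tperm i j x.1, tperm i j x.2)).
  by move=> [a b] [a' b'] /= [/perm_inj -> /perm_inj ->].
rewrite (reindex_inj inj2) /= (bigD1 (i, j)) //= [ltnRHS](bigD1 (i, j)) //=.
rewrite !permM !tpermK tpermL tpermR gji andbT.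
have -> : (i < j) by rewrite ji.
have -> : (j < i) = false by apply/negbTE; rewrite -leqNgt ji.
rewrite /= add0n add1n ltnS; apply: leq_sum => -[a b] /= ab.
rewrite !permM !tpermK.
case: (boolP (g b < g a)) => gba; rewrite ?andbF // !andbT.
have neq : ~~ ((a == i) && (b == j)) by move: ab; rewrite xpair_eqE.
have sep (x y : 'I_N) : (x == y) = (x == y :> nat) by [].
case: tpermP => [ea|ea|/eqP ai /eqP aj]; case: tpermP => [eb|eb|/eqP bi /eqP bj];
  move: neq gba; rewrite ?ea ?eb ?eqxx ?sep /= => neq gba;
  rewrite ?sep; try (rewrite !sep in ai aj); try (rewrite !sep in bi bj); lia.
Qed.

Lemma sum_ord_interval (m a b : nat) : \sum_(j < m) (a < j <= b) <= b - a.
Proof.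
suff : \sum_(j < m) (a < j <= b) <= minn (m - a.+1) (b - a) by lia.
elim: m => [|m IH]; first by rewrite big_ord0.
rewrite big_ord_recr /=; set S := (\sum_(i < m) _) in IH *; case: (boolP (a < m <= b)) => /= H; lia.
Qed.

Definition displacement p q : nat := \sum_(i < N) ((p i - q i) + (q i - p i)).

(** Part of the Diaconis-Graham inequalities. An inversion [i < j] has either [j <= g i], and is
    charged to [i], or [g i <= j], and is charged to [j]; an index is charged at most as often as it
    is displaced to the right, respectively to the left. *)
Lemma inversions_le g : inversions g <= displacement 1%g g.
Proof.
have -> : displacement 1%g g = \sum_(i < N) (g i - i) + \sum_(i < N) (i - g i).
  by rewrite -big_split; apply: eq_bigr => i _ /=; rewrite perm1 addnC.
pose S1 := \sum_(i < N) \sum_(j < N) (i < j <= g i).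
pose S2 := \sum_(i < N) \sum_(j < N) (g j < g i <= j).
apply: (@leq_trans (S1 + S2)).
  rewrite /S1 /S2 -big_split; apply: leq_sum => i _ /=.
  rewrite -big_split; apply: leq_sum => j _ /=; lia.
apply: leq_add; first by apply: leq_sum => i _; exact: sum_ord_interval.
rewrite /S2 exchange_big /=; apply: leq_sum => j _.
rewrite (reindex_inj (@perm_inj _ g^-1%g)) /=.
under eq_bigr do rewrite permKV.
exact: sum_ord_interval.
Qed.

Lemma incr_perm_id g l : (forall i : 'I_N, l < i -> g i = i) ->
  (forall i j : 'I_N, i < j -> j <= l -> g i < g j) -> g = 1%g.
Proof.
move=> gl gi; apply/permP => x; rewrite perm1.
have incr (i j : 'I_N) : i < j -> g i < g j.
  move=> ij; case: (leqP j l) => jl; first exact: gi.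
  rewrite (gl j) //; case: (leqP i l) => il; last by rewrite (gl i).
  rewrite ltnNge; apply/negP => jg.
  have : g (g i) = g i by apply: gl; lia.
  by move/perm_inj => e; move: jg; rewrite e; lia.
have ge m : forall i : 'I_N, i = m :> nat -> m <= g i.
  elim: m => [|m IH] i im //.
  have mN : m < N by have := ltn_ord i; lia.
  have := IH (Ordinal mN) erefl; have := incr (Ordinal mN) i; rewrite im /=.
  by move=> /(_ (ltnSn m)); lia.
have le m : forall i : 'I_N, i + m = n -> g i <= i.
  elim: m => [|m IH] i im; first by have := ltn_ord (g i); lia.
  have mN : i.+1 < N by lia.
  have := IH (Ordinal mN); have := incr i (Ordinal mN); rewrite /=; lia.
apply: val_inj; apply/eqP; rewrite eqn_leq /= (ge x) //.
by rewrite andbT (le (n - x)) //; have := ltn_ord x; lia.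
Qed.

(* Gnome sort: the cursor, at location [s], has sorted the locations up to [s];
   it moves up when the next two entries are in order, and otherwise swaps them
   and moves down. *)
Lemma gnome_sort l g s : s <= l <= n -> (forall i : 'I_N, l < i -> g i = i) ->
  (forall i j : 'I_N, i < j -> j <= s -> g i < g j) ->
  word_dist 1%g (cgen n ^+ s * g)%g <= 3 * inversions g + (l - s) + l.
Proof.
(* A swap lowers the first summand by at least 2 and raises [l - s] by at most 1. In the bound, each
   inversion pays 3: the swap, the move down, and the location to be revisited. The final [l] pays
   for the return of the cursor. *)
move: {2}(2 * inversions g + (l - s)) (leqnn (2 * inversions g + (l - s))) => k.
elim: k g s => [|k IH] g s kle /andP[sl ln] gl gs.
  have -> : g = 1%g by apply: incr_perm_id gl _ => i j ij jl; apply: gs; lia.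
  rewrite mulg1 -[X in word_dist _ X]mul1g.
  by apply: leq_trans (word_distMcX 1%g s) _; lia.
case: (ltnP s l) => [s_l|l_s]; last first.
  have -> : g = 1%g by apply: incr_perm_id gl _ => i j ij jl; apply: gs; lia.
  rewrite mulg1 -[X in word_dist _ X]mul1g.
  by apply: leq_trans (word_distMcX 1%g s) _; lia.
have iN : s < N by lia.
have jN : s.+1 < N by lia.
pose i := Ordinal iN; pose j := Ordinal jN.
have cV1 : word_dist 1%g ((cgen n)^-1)%g <= 1.
  have := word_distMcX ((cgen n)^-1)%g 1.
  by rewrite expg1 mulVg word_dist_sym.
have c1 : word_dist 1%g (cgen n)%g <= 1.
  by have := word_distMcX 1%g 1; rewrite expg1 mul1g.
have t1 : word_dist 1%g (tgen n)%g <= 1.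
  by have := word_distMt 1%g; rewrite mul1g.
have [gij|gji] := ltnP (g i) (g j).
  have -> : (cgen n ^+ s * g = (cgen n)^-1 * (cgen n ^+ s.+1 * g))%g.
    by rewrite expgS -!mulgA mulKg.
  apply: leq_trans (word_dist1M _ _) _.
  have H : word_dist 1%g (cgen n ^+ s.+1 * g)%g <=
      3 * inversions g + (l - s.+1) + l.
    apply: IH => //; [lia|lia|] => a b ab; rewrite leq_eqVlt => /orP[/eqP bs|bs].
      have -> : b = j by apply: val_inj.
      have [e|ne] := eqVneq a i; first by rewrite e.
      apply: ltn_trans gij; apply: gs => //=.
      by move: ne; rewrite -(inj_eq val_inj) /=; lia.
    exact: gs.
  lia.
have lt_gji : g j < g i.
  rewrite ltn_neqAle gji andbT (inj_eq val_inj) (inj_eq perm_inj).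
  by rewrite -(inj_eq val_inj) /=; lia.
have inv_lt := @inversions_swap g i j erefl lt_gji.
set g' := (tperm i j * g)%g in inv_lt *.
have e : (cgen n ^+ s * g = tgen n * (cgen n ^+ s * g'))%g.
  by rewrite /g' -(@tgen_cgenX s i j) // -!mulgA mulKVg !mulgA /tgen tperm2 mul1g.
rewrite e; apply: leq_trans (word_dist1M _ _) _.
have g'l (x : 'I_N) : l < x -> g' x = x.
  move=> lx; rewrite permM tpermD ?gl // -(inj_eq val_inj) /=; lia.
have [s0|s0] := posnP s.
  have H : word_dist 1%g (cgen n ^+ s * g')%g <= 3 * inversions g' + (l - s) + l.
    by apply: IH => //; [lia|lia|] => a b; lia.
  lia.
have -> : (cgen n ^+ s * g' = cgen n * (cgen n ^+ s.-1 * g'))%g.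
  by rewrite [RHS]mulgA -expgS prednK.
have H : word_dist 1%g (cgen n ^+ s.-1 * g')%g <=
    3 * inversions g' + (l - s.-1) + l.
  apply: IH => //; [lia|lia|] => a b ab bs.
  rewrite !permM !tpermD; try (by rewrite -(inj_eq val_inj) /=; lia).
  by apply: gs => //; lia.
have := word_dist1M (cgen n) (cgen n ^+ s.-1 * g')%g.
lia.
Qed.

Lemma displacementMl g p q : displacement (g * p)%g (g * q)%g = displacement p q.
Proof.
rewrite /displacement [RHS](reindex_inj (@perm_inj _ g)).
by apply: eq_bigr => i _; rewrite !permM.
Qed.

Lemma word_dist_displacement l p q : l <= n ->
  (forall i : 'I_N, l < p i -> q i = p i) ->
  word_dist p q <= 3 * displacement p q + 2 * l.
Proof.
move=> ln pq; rewrite word_dist1.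
have H : word_dist 1%g (cgen n ^+ 0 * (p^-1 * q))%g <=
    3 * inversions (p^-1 * q)%g + (l - 0) + l.
  apply: gnome_sort => //; last by move=> i j; lia.
  by move=> i li; rewrite permM pq permKV.
rewrite expg0 mul1g in H; apply: leq_trans H _.
have := inversions_le (p^-1 * q)%g.
rewrite -(displacementMl p) mulg1 mulKVg; lia.
Qed.

End WordMetric.

(** * Rotation-invariant displacement *)

Lemma sum_ord_count (m a b : nat) : a <= b <= m -> \sum_(j < m) (a <= j < b) = b - a.
Proof.
elim: m a b => [|m IH] a b ab; first by rewrite big_ord0; lia.
rewrite big_ord_recr /=.
have [bm|bm] := leqP b m; first by rewrite IH; lia.
have [am|am] := leqP a m; last first.
  by rewrite big1 => [|i _]; [lia|have := ltn_ord i; lia].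
have -> : \sum_(i < m) (a <= i < b) = \sum_(i < m) (a <= i < m).
  by apply: eq_bigr => i _; have := ltn_ord i; lia.
by rewrite IH; lia.
Qed.

Section AngularDistance.
Context (n : nat).
Local Notation N := n.+1.
Implicit Types (p q r : 'S_N) (u v w x : 'I_N).

Definition gap (a b : 'I_N) : nat := (a - b) + (b - a).

(** Averaging the linear distance over all rotations gives a rotation-invariant metric on Z/N that
    is an explicit sum of absolute differences, hence of l_1 type. For points with gap g its value
    is 2 g (N - g). *)
Definition circ_dist u v : nat := \sum_(s < N) gap (u + s)%R (v + s)%R.

Lemma circ_distDr w u v : circ_dist (u + w)%R (v + w)%R = circ_dist u v.
Proof.
rewrite /circ_dist [RHS](reindex_inj (addrI w)) /=.
by apply: eq_bigr => s _; rewrite !addrA.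
Qed.

Lemma circ_distDl w u v : circ_dist (w + u)%R (w + v)%R = circ_dist u v.
Proof. by rewrite ![(w + _)%R]addrC circ_distDr. Qed.

Lemma circ_distC u v : circ_dist u v = circ_dist v u.
Proof. by apply: eq_bigr => s _; rewrite /gap addnC. Qed.

Lemma circ_distxx u : circ_dist u u = 0.
Proof. by apply: big1 => s _; rewrite /gap subnn. Qed.

Lemma circ_dist_triangle v u w : circ_dist u w <= circ_dist u v + circ_dist v w.
Proof. by rewrite /circ_dist -big_split leq_sum // => s _; rewrite /gap /=; lia. Qed.

Lemma circ_distN u v : circ_dist (- u)%R (- v)%R = circ_dist u v.
Proof.
rewrite -(circ_distDr (u + v)%R) addKr circ_distC.
by congr (circ_dist _ _); rewrite [(u + v)%R]addrC addKr.
Qed.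

Lemma val_addr u v : nat_of_ord (u + v)%R = (u + v) %% N.
Proof. by []. Qed.

Lemma val_subr u v : v <= u -> nat_of_ord (u - v)%R = u - v.
Proof.
move=> vu; have := ltn_ord u => uN; rewrite val_addr /= modnDmr.
have -> : u + (N - v) = N + (u - v) by lia.
by rewrite modnDl modn_small //; lia.
Qed.

Lemma circ_dist_ge u v : gap u v * (N - gap u v) <= circ_dist u v.
Proof.
wlog vu : u v / v <= u.
  move=> H; case: (leqP v u) => [/H //|/ltnW/H].
  by rewrite circ_distC [gap v u]addnC.
rewrite -(circ_distDr (- v)%R) subrr.
have xE := val_subr vu.
have -> : gap u v = nat_of_ord (u - v)%R by rewrite xE /gap; lia.
move: (u - v)%R => x {xE}.
have -> : N - x = \sum_(s < N) (0 <= s < N - x).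
  by rewrite sum_ord_count ?subn0 //; have := ltn_ord x; lia.
rewrite big_distrr; apply: leq_sum => s _ /=.
case: ltnP => sx; last by rewrite muln0.
rewrite muln1 add0r /gap val_addr modn_small; lia.
Qed.

Lemma circ_dist_succ u v : val v = u.+1 -> circ_dist u v <= 2 * N.
Proof.
move=> vE; rewrite -(circ_distDr (- u)%R) subrr.
have : nat_of_ord (v - u)%R = 1 by rewrite val_subr vE; lia.
move: (v - u)%R => x x1.
apply: (@leq_trans (\sum_(s < N) (1 + N * (n <= s < N)))).
  apply: leq_sum => s _; rewrite add0r /gap val_addr x1.
  have := ltn_ord s; rewrite ltnS leq_eqVlt => /orP[/eqP ->|sn].
    by rewrite modnn; lia.
  by rewrite modn_small; lia.
by rewrite big_split -big_distrr /= sum_ord_count ?sum1_card ?card_ord; lia.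
Qed.

Definition angular_dist p q : nat :=
  \sum_(i < N) \sum_(j < N) circ_dist (p i - p j)%R (q i - q j)%R.

Lemma angular_distxx p : angular_dist p p = 0.
Proof. by apply: big1 => i _; apply: big1 => j _; rewrite circ_distxx. Qed.

Lemma angular_distC p q : angular_dist p q = angular_dist q p.
Proof. by apply: eq_bigr => i _; apply: eq_bigr => j _; rewrite circ_distC. Qed.

Lemma angular_dist_triangle q p r :
  angular_dist p r <= angular_dist p q + angular_dist q r.
Proof.
rewrite /angular_dist -big_split leq_sum // => i _; rewrite -big_split leq_sum // => j _.
exact: circ_dist_triangle.
Qed.

Lemma angular_dist_le p q :
  angular_dist p q <= 2 * N * \sum_(i < N) circ_dist (p i) (q i).
Proof.
apply: (@leq_trans (\sum_(i < N) \sum_(j < N)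
    (circ_dist (p i) (q i) + circ_dist (p j) (q j)))).
  rewrite leq_sum // => i _; rewrite leq_sum // => j _.
  apply: leq_trans (circ_dist_triangle (q i - p j)%R _ _) _.
  by rewrite circ_distDr circ_distDl circ_distN.
under eq_bigr do rewrite big_split sum_nat_const card_ord /=.
rewrite big_split /= sum_nat_const card_ord -big_distrr /=; lia.
Qed.

Lemma cgenXE k p i : (p * cgen n ^+ k)%g i = (p i + inord (k %% N))%R.
Proof.
apply: val_inj; rewrite permM [LHS]val_cgenX [RHS]val_addr.
by rewrite inordK ?ltn_pmod // modnDmr.
Qed.

Lemma angular_dist_rot k l p q :
  angular_dist (p * cgen n ^+ k)%g (q * cgen n ^+ l)%g = angular_dist p q.
Proof.
apply: eq_bigr => i _; apply: eq_bigr => j _; rewrite !cgenXE.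
by congr (circ_dist _ _); rewrite opprD addrACA subrr addr0.
Qed.

Lemma word_dist_lipschitz (D : 'S_N -> 'S_N -> nat) K :
  (forall p, D p p = 0) -> (forall p q, D p q = D q p) ->
  (forall q p r, D p r <= D p q + D q r) ->
  (forall p, D p (p * tgen n)%g <= K) -> (forall p, D p (p * cgen n)%g <= K) ->
  forall p q, D p q <= K * word_dist p q.
Proof.
move=> D0 DC DT Dt Dc p q.
have /cayley_walkP[s [ps ls <-]] := word_dist_walk p q.
elim: s p ps ls => [|x s IH] p /=; first by move=> _ ->; rewrite D0.
move=> /andP[px ps] ls; apply: leq_trans (DT x _ _) _.
have := IH x ps ls; suff : D p x <= K by lia.
by case/or4P: px => /eqP ->; rewrite 1?[D (_ * _)%g _]DC.
Qed.

Lemma tgen_small x : tgen n x = x \/ x < 2 /\ tgen n x < 2.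
Proof.
rewrite /tgen; case: tpermP => [->|->|]; [right|right|by left]; split=> //.
  by apply: leq_ltn_trans (leq_mod _ _) _.
by apply: leq_ltn_trans (leq_mod _ _) _.
Qed.

(** A step by [c] is free, since only differences enter. A step by [t] moves two labels, each by at
    most 2 N in [circ_dist], and each label occurs in 2 N differences: 8 N^2 in all. *)
Lemma angular_dist_word p q : angular_dist p q <= 8 * N ^ 2 * word_dist p q.
Proof.
apply: word_dist_lipschitz => //.
- exact: angular_distxx.
- exact: angular_distC.
- exact: angular_dist_triangle.
- move=> {}p; apply: leq_trans (angular_dist_le _ _) _.
  rewrite (reindex_inj (@perm_inj _ p^-1%g)) /=.
  under eq_bigr do rewrite permM !permKV.
  rewrite -mulnn; set S := \sum_(i < N) _; suff HS : S <= 4 * N by apply: leq_trans (leq_mul (leqnn _) HS) _; lia.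
  rewrite /S.
  (* The minimum covers N = 1, where [t] is the identity and there is only one location. *)
  apply: (@leq_trans (\sum_(i < N) 2 * N * (0 <= i < minn 2 N))).
    have c01 : circ_dist ord0 (ordS ord0) <= 2 * N.
      have [n0|n0] := posnP n.
        have -> : ordS ord0 = ord0 :> 'I_N by apply: val_inj; rewrite /= n0.
        by rewrite circ_distxx.
      by apply: circ_dist_succ; rewrite /= modn_small.
    have lt1 : 1 %% N < minn 2 N.
      by rewrite leq_min ltn_mod (leq_ltn_trans (leq_mod _ _)).
    apply: leq_sum => i _; rewrite /tgen; case: tpermP => [->|->|].
    + by rewrite leq_min /= muln1.
    + by rewrite circ_distC /= lt1 muln1.
    + by rewrite circ_distxx.
  rewrite -big_distrr sum_ord_count ?geq_minr // subn0.
  by apply: leq_trans (leq_mul (leqnn _) (geq_minl 2 N)) _; lia.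
- move=> {}p; rewrite -[cgen n]expg1 -{1}[p]mulg1 -{1}(expg0 (cgen n)).
  by rewrite angular_dist_rot angular_distxx.
Qed.

(** At least N / 2 labels [j] stay in place, and each sees the full [circ_dist (p i) (q i)] in its
    difference with [i]. The moving labels stay among the first [l] locations, so their gaps are at
    most N / 2 and [circ_dist] is at least N / 2 times the gap. Each halving accounts for a factor
    2. *)
Lemma displacement_angular l p q : 2 * l <= N ->
  (forall i, l <= p i -> q i = p i) ->
  N ^ 2 * displacement p q <= 4 * angular_dist p q.
Proof.
move=> lN pq.
have ql i : p i < l -> q i < l.
  move=> pil; rewrite ltnNge; apply/negP => lqi.
  have := pq (p^-1%g (q i)); rewrite permKV => /(_ lqi)/perm_inj e.
  by move: lqi pil; rewrite -e permKV e; lia.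
have gl i : 2 * gap (p i) (q i) <= N.
  case: (ltnP (p i) l) => [pil|/pq ->]; last by rewrite /gap subnn.
  by have := ql _ pil; rewrite /gap; lia.
have cnt : \sum_(j < N) (l <= p j < N) = N - l.
  rewrite (reindex_inj (@perm_inj _ p^-1%g)) /=.
  under eq_bigr do rewrite permKV.
  by rewrite sum_ord_count; lia.
have H : (N - l) * \sum_(i < N) circ_dist (p i) (q i) <= angular_dist p q.
  rewrite big_distrr leq_sum //= => i _; rewrite -cnt big_distrl leq_sum //= => j _.
  case: (leqP l (p j)) => [/pq ->|]; last by rewrite mul0n.
  by rewrite circ_distDr ltn_ord mul1n.
have H2 : N * displacement p q <= 2 * \sum_(i < N) circ_dist (p i) (q i).
  rewrite /displacement !big_distrr leq_sum //= => i _.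
  have := circ_dist_ge (p i) (q i); have := gl i.
  rewrite -/(gap (p i) (q i)); nia.
nia.
Qed.

(* The pigeonhole principle over the N^2 pairs (j, s) produces a rotation of [p]
   and one of [q] whose displacement is at most the average. *)
Lemma word_dist_angular p q :
  N ^ 2 * word_dist p q <= 4 * N ^ 3 + 3 * angular_dist p q.
Proof.
pose D (js : 'I_N * 'I_N) :=
  \sum_(i < N) gap (p i - p js.1 + js.2)%R (q i - q js.1 + js.2)%R.
have [js jsP] : exists js, N ^ 2 * D js <= angular_dist p q.
  apply/existsP; apply: contraT; rewrite negb_exists => /forallP H.
  have E : angular_dist p q = \sum_js D js.
    rewrite -(pair_big xpredT xpredT (fun j s => D (j, s))) /=.
    rewrite /angular_dist exchange_big /=; apply: eq_bigr => j _.
    by rewrite exchange_big.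
  have : \sum_(js : 'I_N * 'I_N) (angular_dist p q).+1 <= \sum_js N ^ 2 * D js.
    by apply: leq_sum => js _; have := H js; rewrite -ltnNge.
  rewrite sum_nat_const card_prod card_ord -big_distrr /= -E -mulnn; nia.
have rot r : exists r', word_dist r r' <= N /\
    forall i, r' i = (r i - r js.1 + js.2)%R.
  exists (r * cgen n ^+ nat_of_ord (js.2 - r js.1)%R)%g; split.
    by apply: leq_trans (word_distMcX _ _) _; rewrite ltnW.
  move=> i; rewrite cgenXE modn_small // inord_val; rewrite -addrA; congr (_ + _)%R.
  by rewrite addrC.
have [p' [pp' p'E]] := rot p; have [q' [qq' q'E]] := rot q.
have : displacement p' q' = D js.
  by apply: eq_bigr => i _; rewrite p'E q'E.
have := @word_dist_displacement n n p' q' (leqnn _) _.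
have := word_dist_triangle p' p q; have := word_dist_triangle q' p' q.
rewrite (word_dist_sym q' q) => H1 H2 H3 H4.
have {}H3 : word_dist p' q' <= 3 * displacement p' q' + 2 * n.
  by apply: H3 => i; have := ltn_ord (p' i); lia.
have : word_dist p q <= 4 * N + 3 * D js by lia.
rewrite -mulnn in jsP *; nia.
Qed.

End AngularDistance.

(** * Words along arcs *)

Section Arcs.
Context (n : nat).
Local Notation N := n.+1.
Implicit Types (p q r : 'S_N) (i j k : 'I_N).

(* The arc of the arrangement [p] from label [i] to label [j], recorded up to
   rotation; it is [None] unless the arc avoids the locations 0 and 1 where [t]
   acts and does not cross the cut between the locations n and 0. *)
Definition arc_word p (ij : 'I_N * 'I_N) : option {ffun 'I_N -> option 'I_N} :=
  if 2 <= p ij.1 <= p ij.2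
  then Some [ffun k => if p ij.1 <= p k <= p ij.2 then Some (p k - p ij.1)%R
                       else None]
  else None.

Definition arc_mismatch p q : nat :=
  \sum_(ij : 'I_N * 'I_N) (arc_word p ij != arc_word q ij).

Lemma arc_word_tgen p ij : arc_word (p * tgen n)%g ij = arc_word p ij.
Proof.
case: ij => i j; rewrite /arc_word /= !permM.
have ti := tgen_small (p i); have tj := tgen_small (p j).
have -> : (2 <= tgen n (p i) <= tgen n (p j)) = (2 <= p i <= p j).
  by case: ti => [->|[? ?]]; case: tj => [->|[? ?]]; lia.
case: ifP => // pij; congr Some; apply/ffunP => k; rewrite !ffunE permM.
have {ti} -> : tgen n (p i) = p i by case: ti => // -[]; lia.
have {tj} -> : tgen n (p j) = p j by case: tj => // -[]; lia.
by case: (tgen_small (p k)) => [->|[? ?]] //; rewrite !ifN //; lia.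
Qed.

Lemma val_cgen (x : 'I_N) : nat_of_ord (cgen n x) = if x < n then x.+1 else 0.
Proof.
rewrite permE /=; case: ltnP => xn; first by rewrite modn_small.
have -> : x = n :> nat by have := ltn_ord x; lia.
by rewrite modnn.
Qed.

(** A shift keeps the entries of an arc relative to its start. The two exceptions are a start that
    leaves location 1, making the arc visible, and an end that crosses the cut after location n. *)
Lemma arc_word_cgen p ij : p ij.1 != 1 :> nat -> p ij.2 != n :> nat ->
  arc_word (p * cgen n)%g ij = arc_word p ij.
Proof.
case: ij => i j /= pi1 pjn; rewrite /arc_word /= !permM.
have -> : (2 <= cgen n (p i) <= cgen n (p j)) = (2 <= p i <= p j).
  rewrite !val_cgen; have := ltn_ord (p i); have := ltn_ord (p j).
  by case: (ltnP (p i) n); case: (ltnP (p j) n); lia.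
case: ifP => // pij; congr Some; apply/ffunP => k; rewrite !ffunE permM.
have -> : (cgen n (p i) <= cgen n (p k) <= cgen n (p j)) = (p i <= p k <= p j).
  rewrite !val_cgen; have := ltn_ord (p i); have := ltn_ord (p j).
  have := ltn_ord (p k).
  by case: (ltnP (p i) n); case: (ltnP (p j) n); case: (ltnP (p k) n); lia.
case: ifP => // _; congr Some.
have cE x : cgen n x = (x + inord (1 %% N))%R.
  by have := cgenXE 1 1%g x; rewrite mul1g expg1 perm1.
by rewrite !cE opprD addrACA subrr addr0.
Qed.

Lemma sum_perm_eq p (a : nat) : \sum_(i < N) (p i == a :> nat) <= 1.
Proof.
rewrite (reindex_inj (@perm_inj _ p^-1%g)) /=; under eq_bigr do rewrite permKV.
have [aN|Na] := ltnP a N; last by rewrite big1 // => i _; have := ltn_ord i; lia.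
rewrite (bigD1 (Ordinal aN)) //= eqxx big1 // => i.
by rewrite -(inj_eq val_inj) /= => /negbTE ->.
Qed.

(** Only [c] matters, and it changes at most N arcs with a given start and N arcs with a given
    end. *)
Lemma arc_mismatch_word p q : arc_mismatch p q <= 2 * N * word_dist p q.
Proof.
apply: (word_dist_lipschitz (D := arc_mismatch)).
- by move=> r; apply: big1 => ij _; rewrite eqxx.
- by move=> r s; apply: eq_bigr => ij _; rewrite eq_sym.
- move=> r s t; rewrite /arc_mismatch -big_split leq_sum // => ij _ /=.
  have [->|_] := eqVneq (arc_word r ij) (arc_word s ij); first by [].
  by case: (_ != _).
- by move=> r; rewrite /arc_mismatch big1 // => ij _; rewrite arc_word_tgen eqxx.
- move=> r; rewrite /arc_mismatch.
  apply: (@leq_trans (\sum_(ij : 'I_N * 'I_N)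
      ((r ij.1 == 1 :> nat) + (r ij.2 == n :> nat)))).
    apply: leq_sum => ij _.
    case: (boolP (r ij.1 == 1 :> nat)) => [_|r1]; first by case: (_ != _).
    case: (boolP (r ij.2 == n :> nat)) => [_|r2]; first by case: (_ != _).
    by rewrite arc_word_cgen // eqxx.
  rewrite -(pair_big xpredT xpredT
    (fun i j => (r i == 1 :> nat) + (r j == n :> nat))) /=.
  under eq_bigr do rewrite big_split sum_nat_const card_ord /=.
  rewrite big_split /= sum_nat_const card_ord -big_distrr /=.
  rewrite -mulnDr mulnC leq_mul2r; apply/orP; right.
  exact: leq_add (sum_perm_eq r 1) (sum_perm_eq r n).
Qed.

(** The hypothesis [2 <= p i <= p j] makes the first word a genuine one, so the agreement is not
    that of two [None]. *)
Lemma arc_word_eq p q i j : 2 <= p i <= p j -> arc_word p (i, j) = arc_word q (i, j) ->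
  forall k, p i <= p k <= p j -> p k + q i = q k + p i.
Proof.
move=> pij; rewrite /arc_word /= pij; case: ifP => // qij -[/ffunP e] k pk.
have := e k; rewrite !ffunE pk; case: ifP => // qk [E].
have : nat_of_ord (p k - p i)%R = nat_of_ord (q k - q i)%R := E.
by rewrite !val_subr; lia.
Qed.

(** Pigeonhole: A * B arcs of [p] start in the first window of locations and end in the second, and
    each one that disagrees counts as a mismatch. *)
Lemma arc_word_grid p q (a A b B : nat) : a + A <= N -> b + B <= N ->
  arc_mismatch p q < A * B ->
  exists i j, [/\ a <= p i < a + A, b <= p j < b + B &
                  arc_word p (i, j) = arc_word q (i, j)].
Proof.
move=> aA bB lt.
have [[i j] /and3P[pi pj /eqP e]] : exists ij, [&& a <= p ij.1 < a + A,
    b <= p ij.2 < b + B & arc_word p ij == arc_word q ij].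
  apply/existsP; apply: contraLR lt; rewrite negb_exists -leqNgt => /forallP H.
  have cnt (c C : nat) : c + C <= N -> C = \sum_(i < N) (c <= p i < c + C).
    move=> cN; rewrite (reindex_inj (@perm_inj _ p^-1%g)) /=.
    by under eq_bigr do rewrite permKV; rewrite sum_ord_count; lia.
  rewrite (cnt a A) // (cnt b B) // big_distrl /=.
  under eq_bigr do rewrite big_distrr /=.
  rewrite pair_big /= leq_sum // => ij _; have := H ij.
  by do 2 case: (_ <= _ < _) => //=; case: eqP.
by exists i, j.
Qed.

(** With l the number of locations of [p] outside the common arc, rotating both arrangements until
    the arc ends at location n takes at most l steps each, and afterwards they differ only in the
    first l locations. Sorting there costs three times the displacement plus 2 l, and
    [displacement_angular] turns the factor 3 into 12. *)
Lemma word_dist_arc p q i j : p i <= p j ->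
  (forall k, p i <= p k <= p j -> p k + q i = q k + p i) ->
  2 * (p i + n - p j) <= N ->
  N ^ 2 * word_dist p q <= 12 * angular_dist p q + 4 * (p i + n - p j) * N ^ 2.
Proof.
move=> pij H lN; set l := p i + n - p j in lN *.
have qj : p j + q i = q j + p i by apply: H; lia.
have pjN := ltn_ord (p j); have qjN := ltn_ord (q j).
have qiN := ltn_ord (q i).
pose p' := (p * cgen n ^+ (n - p j))%g; pose q' := (q * cgen n ^+ (n - q j))%g.
have pq k : l <= p' k -> q' k = p' k.
  have pkN := ltn_ord (p k).
  move=> lk; apply: val_inj; move: lk; rewrite /= !permM !val_cgenX.
  have [pk|pk] := boolP (p i <= p k <= p j).
    have qk := H _ pk; have qkN := ltn_ord (q k); rewrite !modn_small; lia.
  have [pki|pki] := ltnP (p k) (p i); first by rewrite modn_small; lia.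
  have -> : p k + (n - p j) = N + (p k - p j).-1 by lia.
  by rewrite modnDl modn_small; lia.
have := word_distMcX p (n - p j); have := word_distMcX q (n - q j).
rewrite -/p' -/q' => dq dp.
have := word_dist_displacement (p := p') (q := q') (l := l) _ _.
have -> : l <= n by lia.
move=> /(_ isT) /(_ (fun k lk => pq k (ltnW lk))) dpq.
have A := displacement_angular lN pq; rewrite angular_dist_rot in A.
have := word_dist_triangle p' p q; have := word_dist_triangle q' p' q.
rewrite (word_dist_sym q' q) => T1 T2.
have : word_dist p q <= 3 * displacement p' q' + 4 * l by lia.
nia.
Qed.

Lemma word_dist_upper p q :
  N ^ 2 * word_dist p q <=
    1024 * (N ^ 2 + angular_dist p q + N * arc_mismatch p q).
Proof.
have A := word_dist_angular p q.
have [N8|N8] := ltnP N 16; first by rewrite -mulnn expnS -mulnn in A *; nia.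
pose H := N %/ 8.
have H0 : 0 < H by rewrite /H; lia.
have HN : 8 * H <= N <= 16 * H by rewrite /H; lia.
pose M := arc_mismatch p q %/ H.
have MH : M * H <= arc_mismatch p q < M.+1 * H.
  by rewrite leq_trunc_div ltn_ceil.
have [HM|MltH] := leqP H M.
  suff : N ^ 3 <= 256 * (N * arc_mismatch p q) by lia.
  rewrite expnS -mulnn [256 * _]mulnCA leq_mul2l; apply/orP; right; nia.
have [i [j' [pi pj' e]]] := @arc_word_grid p q 2 M.+1 (N - M.+1 - H) H
  ltac:(lia) ltac:(lia) ltac:(lia).
have [i' [j [pi' pj e']]] := @arc_word_grid p q (2 + M.+1) H (N - M.+1) M.+1
  ltac:(lia) ltac:(lia) ltac:(lia).
have C1 := arc_word_eq _ e; have C2 := arc_word_eq _ e'.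
have {}C1 := C1 ltac:(lia); have {}C2 := C2 ltac:(lia).
have := @word_dist_arc p q i j ltac:(lia) _ ltac:(lia).
(* Both arcs contain the label [i'], so their two shifts coincide. *)
have C : forall k, p i <= p k <= p j -> p k + q i = q k + p i.
  move=> k pk; have := C1 i' ltac:(lia); case: (leqP (p k) (p j')) => pkj.
    by have := C1 k ltac:(lia); lia.
  by have := C2 k ltac:(lia); lia.
move=> /(_ C) B.
have l2 : p i + n - p j <= 2 * M.+1 by lia.
have NM : N * M.+1 <= 16 * arc_mismatch p q + N.
  rewrite mulnS addnC leq_add2r; case/andP: MH => MH _.
  apply: leq_trans (_ : 16 * (M * H) <= _); last by rewrite leq_mul2l MH orbT.
  by rewrite [M * H]mulnC mulnA leq_mul2r; case/andP: HN => _ ->; rewrite orbT.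
have lNN : 4 * (p i + n - p j) * N ^ 2 <= 8 * ((16 * arc_mismatch p q + N) * N).
  apply: leq_trans (_ : 8 * ((N * M.+1) * N) <= _).
    rewrite [N * M.+1]mulnC -!mulnA mulnn mulnA (mulnA 8) leq_mul2r.
    by apply/orP; right; lia.
  by rewrite leq_mul2l leq_mul2r NM !orbT.
apply: leq_trans B _; rewrite mulnDl -mulnA (mulnC _ N) mulnn in lNN.
lia.
Qed.

End Arcs.

(** * Cubes in the symmetric group *)

Section Cube.
Context (m : nat).
Local Notation n := (4 * m).
Local Notation N := n.+1.
Implicit Types (x y : {ffun 'I_m -> bool}) (i : 'I_N).

Definition cube_bit x (k : nat) : bool := oapp x false (insub k).

Definition swap_half x (k : nat) : nat :=
  if (k < m) && cube_bit x k then k + m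
  else if (m <= k < 2 * m) && cube_bit x (k - m) then k - m else k.

Lemma swap_half_lt x k : k < N -> swap_half x k < N.
Proof. by rewrite /swap_half; do 2?[case: ifP]; lia. Qed.

Lemma swap_half_lo x k : k < m -> swap_half x k = if cube_bit x k then k + m else k.
Proof.
move=> km; rewrite /swap_half km /=; case: (cube_bit x k) => //.
by have -> : (m <= k) = false by lia.
Qed.

Lemma swap_half_hi x k : k < m ->
  swap_half x (k + m) = if cube_bit x k then k else k + m.
Proof.
move=> km; rewrite /swap_half addnK; have -> : (k + m < m) = false by lia.
by have -> : (m <= k + m < 2 * m) by lia.
Qed.

Lemma swap_half_fix x k : 2 * m <= k -> swap_half x k = k.
Proof.
move=> mk; rewrite /swap_half; have -> : (k < m) = false by lia.
by have -> : (m <= k < 2 * m) = false by lia.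
Qed.

Variant swap_half_spec : nat -> Type :=
  | SwapLo k of k < m : swap_half_spec k
  | SwapHi k of k < m : swap_half_spec (k + m)
  | SwapFix k of 2 * m <= k : swap_half_spec k.

Lemma swap_halfP k : swap_half_spec k.
Proof.
have [km|mk] := ltnP k m; first exact: SwapLo.
have [k2|k2] := leqP (2 * m) k; first exact: SwapFix.
by rewrite -(subnK mk); apply: SwapHi; lia.
Qed.

Lemma swap_halfK x : involutive (swap_half x).
Proof.
move=> k; case: (swap_halfP k) => {}k km.
- rewrite (swap_half_lo x km); case: ifP => bk; first by rewrite swap_half_hi // bk.
  by rewrite swap_half_lo // bk.
- rewrite (swap_half_hi x km); case: ifP => bk; first by rewrite swap_half_lo // bk.
  by rewrite swap_half_hi // bk.
- by rewrite !swap_half_fix.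
Qed.

Definition cube_fun x i : 'I_N := Ordinal (swap_half_lt x (ltn_ord i)).

Lemma cube_fun_inj x : injective (cube_fun x).
Proof.
by apply: (can_inj (g := cube_fun x)) => i; apply/val_inj/swap_halfK.
Qed.

Definition cube_perm x : 'S_N := perm (@cube_fun_inj x).

Lemma cube_permE x i : nat_of_ord (cube_perm x i) = swap_half x i.
Proof. by rewrite permE. Qed.

Lemma cube_bit_ord x (j : 'I_m) : cube_bit x j = x j.
Proof. by rewrite /cube_bit valK. Qed.

(** Two labels move by [m], so the displacement is at most 2 m; sorting with l = 4 m costs 3 * 2 m +
    2 * 4 m. *)
Lemma cube_perm_edge x y (j : 'I_m) : (forall k, k != j -> x k = y k) ->
  word_dist (cube_perm x) (cube_perm y) <= 14 * m.
Proof.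
move=> xy.
have bE k : k < m -> k != j :> nat -> cube_bit x k = cube_bit y k.
  move=> km kj; rewrite -[k]/(nat_of_ord (Ordinal km)) !cube_bit_ord xy //.
have := @word_dist_displacement _ n (cube_perm x) (cube_perm y) (leqnn _) _.
move=> /(_ (fun i => ltac:(by have := ltn_ord (cube_perm x i); lia))) H.
suff : displacement (cube_perm x) (cube_perm y) <= 2 * m by lia.
apply: (@leq_trans (\sum_(i < N) m * ((j <= i < j.+1) + (j + m <= i < (j + m).+1)))).
  apply: leq_sum => i _; rewrite !cube_permE.
  case: (swap_halfP i) => k km; rewrite ?(swap_half_fix _ km); last by lia.
    rewrite !swap_half_lo //; have [->|kj] := eqVneq k j.
      by rewrite leqnn ltnSn; case: (cube_bit x j); case: (cube_bit y j); lia.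
    by rewrite bE //; lia.
  rewrite !swap_half_hi //; have [->|kj] := eqVneq k j.
    by rewrite leqnn ltnSn; case: (cube_bit x j); case: (cube_bit y j); lia.
  by rewrite bE //; lia.
by rewrite -big_distrr big_split /= !sum_ord_count; have := ltn_ord j; lia.
Qed.

(** The labels from 2 m on never move and serve as a frame of reference: each of the m labels below
    m moves by m relative to 2 m + 1 of them, contributing at least m * 3 m. Hence [angular_dist] is
    at least 6 m^4, while one step changes it by at most 8 N^2 <= 200 m^2. *)
Lemma cube_perm_antipodal x y : (forall j, y j = ~~ x j) ->
  m ^ 2 <= 40 * word_dist (cube_perm x) (cube_perm y).
Proof.
move=> xy; set p := cube_perm x; set q := cube_perm y.
have [m0|m0] := posnP m.
  by have -> : m ^ 2 = 0 by rewrite m0.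
have A : \sum_(i < N) \sum_(j < N) (0 <= i < m) * (2 * m <= j < N) * (m * (3 * m))
    <= angular_dist p q.
  apply: leq_sum => i _; apply: leq_sum => j _.
  case: (boolP (0 <= i < m)) => // /= im; case: (leqP (2 * m) j) => // jm.
  rewrite ltn_ord !mul1n.
  have -> : p j = j by apply: val_inj; rewrite /= cube_permE swap_half_fix.
  have -> : q j = j by apply: val_inj; rewrite /= cube_permE swap_half_fix.
  rewrite circ_distDr; apply: leq_trans (circ_dist_ge _ _).
  have -> : gap (p i) (q i) = m.
    rewrite /gap !cube_permE !swap_half_lo //.
    rewrite -[nat_of_ord i]/(nat_of_ord (Ordinal im)) !cube_bit_ord xy.
    by case: (x _) => /=; lia.
  by rewrite leq_mul2l; lia.
have B := angular_dist_word p q.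
have C : \sum_(i < N) \sum_(j < N) (0 <= i < m) * (2 * m <= j < N) * (m * (3 * m))
   = m * (2 * m).+1 * (m * (3 * m)).
  have e1 : \sum_(i < N) (0 <= i < m) = m by rewrite sum_ord_count; lia.
  have e2 : \sum_(j < N) (2 * m <= j < N) = (2 * m).+1.
    by rewrite sum_ord_count; lia.
  rewrite -e2; set S := \sum_(j < N) (2 * m <= j < N).
  rewrite (_ : m * S = (\sum_(i < N) (0 <= i < m)) * S); last by rewrite e1.
  rewrite 2!big_distrl /=; apply: eq_bigr => i _.
  by rewrite /S big_distrr big_distrl.
have {}A := leq_trans (leq_trans (eq_leq (esym C)) A) B.
have NN : N ^ 2 <= 25 * m ^ 2 by nia.
rewrite -(@leq_pmul2l (m ^ 2 * 5)); last by rewrite -mulnn; nia.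
set d := word_dist p q in A *.
have A2 : 6 * (m ^ 2 * m ^ 2) <= 200 * (m ^ 2 * d).
  apply: (@leq_trans (8 * N ^ 2 * d)); last first.
    by rewrite [200 * _]mulnA leq_mul2r; apply/orP; right; lia.
  by apply: leq_trans A; rewrite -mulnn; nia.
lia.
Qed.

End Cube.

Local Open Scope ring_scope.

(** * Embedding into l_1 *)

Section Embedding.
Context (R : realType) (n : nat).
Local Notation N := n.+1.
Implicit Types (p q : 'S_N).

Lemma sum_indicator_dist (T : finType) (a b : T) :
  \sum_k `|(a == k)%:R - (b == k)%:R : R| = 2 * (a != b)%:R.
Proof.
have [->|ab] := eqVneq a b.
  by rewrite mulr0 big1 // => k _; rewrite subrr normr0.
have ba : (b == a) = false by rewrite eq_sym; apply/negbTE.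
rewrite mulr1 (bigD1 a) //= (bigD1 b) ?ba //= !eqxx (negbTE ab).
rewrite subr0 sub0r normrN normr1 big1 ?addr0 // => k /andP[ka kb].
by rewrite ![_ == k]eq_sym (negbTE ka) (negbTE kb) subrr normr0.
Qed.

Definition l1_index : finType :=
  (('I_N * 'I_N * 'I_N) + (('I_N * 'I_N) * option {ffun 'I_N -> option 'I_N})
   + 'S_N)%type.

(** The coordinates [s] realise the sum defining [circ_dist], and the indicators of words turn each
    mismatch into an l_1 distance 2. The indicators of permutations supply the constant that absorbs
    the term N^2 in [word_dist_upper]. *)
Definition l1_map p (x : l1_index) : R :=
  match x with
  | inl (inl (i, j, s)) => (nat_of_ord (p i - p j + s)%R)%:R / (N ^ 2)%:R
  | inl (inr (ij, w)) => (arc_word p ij == w)%:R / N%:R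
  | inr q => (p == q)%:R
  end.

Lemma l1_distE p q : \sum_x `|l1_map p x - l1_map q x| =
  (angular_dist p q)%:R / (N ^ 2)%:R + 2 * (arc_mismatch p q)%:R / N%:R
  + 2 * (p != q)%:R.
Proof.
rewrite !big_sumType /=; congr (_ + _ + _).
- transitivity (\sum_i \sum_j \sum_s `|l1_map p (inl (inl (i, j, s)))
      - l1_map q (inl (inl (i, j, s)))|).
    by rewrite !pair_bigA /=; apply: eq_bigr => -[[i j] s] _.
  rewrite /angular_dist natr_sum mulr_suml; apply: eq_bigr => i _.
  rewrite natr_sum mulr_suml; apply: eq_bigr => j _.
  rewrite /circ_dist natr_sum mulr_suml; apply: eq_bigr => s _.
  rewrite -mulrBl normrM [`|_^-1|]ger0_norm ?invr_ge0 ?ler0n //; congr (_ / _).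
  rewrite /gap natrD; set a := nat_of_ord _; set b := nat_of_ord _.
  case: (leqP a b) => [ab|/ltnW ba].
    rewrite ler0_norm ?subr_le0 ?ler_nat // opprB (natrB _ ab).
    by rewrite (_ : (a - b)%N = 0%N) ?add0r //; apply/eqP; rewrite subn_eq0.
  rewrite ger0_norm ?subr_ge0 ?ler_nat // (natrB _ ba).
  by rewrite (_ : (b - a)%N = 0%N) ?addr0 //; apply/eqP; rewrite subn_eq0.
- transitivity (\sum_ij \sum_w `|l1_map p (inl (inr (ij, w)))
      - l1_map q (inl (inr (ij, w)))|).
    by rewrite !pair_bigA /=; apply: eq_bigr => -[ij w] _.
  rewrite /arc_mismatch natr_sum mulr_sumr mulr_suml; apply: eq_bigr => ij _.
  rewrite -sum_indicator_dist mulr_suml; apply: eq_bigr => w _.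
  by rewrite -mulrBl normrM [`|_^-1|]ger0_norm ?invr_ge0 ?ler0n.
- by rewrite -sum_indicator_dist.
Qed.

(** The three blocks contribute at most 8, 4 and 2 per unit of word length, and 14336 = 14 *
    1024. *)
Lemma l1_map_dist p q :
  (word_dist p q)%:R <= 1024 * \sum_x `|l1_map p x - l1_map q x| <=
    14336 * (word_dist p q)%:R.
Proof.
rewrite l1_distE; have N0 : 0 < N%:R :> R by rewrite ltr0n.
have N20 : 0 < (N ^ 2)%:R :> R by rewrite ltr0n.
have pq1 : (p != q)%:R <= (word_dist p q)%:R :> R.
  rewrite ler_nat; have [->|pq] := eqVneq p q => //=.
  by rewrite lt0n; apply: contraNneq pq => /word_dist_eq0 ->.
apply/andP; split; last first.
  have A : (angular_dist p q)%:R / (N ^ 2)%:R <= 8 * (word_dist p q)%:R :> R.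
    rewrite ler_pdivrMr // mulrAC -!natrM ler_nat; exact: angular_dist_word.
  have M : 2 * (arc_mismatch p q)%:R / N%:R <= 4 * (word_dist p q)%:R :> R.
    rewrite ler_pdivrMr // -!natrM ler_nat.
    by have := arc_mismatch_word p q; lia.
  move: pq1 A M; move: ((_ != _)%:R) (_ / (N ^ 2)%:R) (_ / N%:R) => x y z.
  by move: ((word_dist p q)%:R) => w; lra.
have [->|pq] := eqVneq p q.
  rewrite word_distxx; apply: mulr_ge0; first exact: ler0n.
  by apply: addr_ge0; [apply: addr_ge0|]; rewrite ?divr_ge0 ?mulr_ge0 ?ler0n.
have U : (N ^ 2)%:R * (word_dist p q)%:R <= 1024 *
    ((N ^ 2)%:R + (angular_dist p q)%:R + N%:R * (arc_mismatch p q)%:R) :> R.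
  by rewrite -[N%:R * _]natrM -!natrD -!natrM ler_nat; exact: word_dist_upper.
rewrite -(ler_pM2l N20); apply: (le_trans U).
rewrite mulrCA ler_pM2l ?ltr0n //= mulr1.
set a := (angular_dist p q)%:R; set m := (arc_mismatch p q)%:R.
have e1 : (N ^ 2)%:R * (a / (N ^ 2)%:R) = a by rewrite mulrC divfK // gt_eqF.
have e2 : (N ^ 2)%:R * (2 * m / N%:R) = 2 * (N%:R * m).
  by rewrite -mulnn natrM; field; rewrite gt_eqF.
rewrite !mulrDr e1 e2.
have : 0 <= N%:R * m by rewrite mulr_ge0.
lra.
Qed.

End Embedding.

Lemma l1_map_bilipschitz (R : realType) : exists c D : R, [/\ 0 <= c, 1 < D &
  forall n (p q : 'S_n.+1), (word_dist p q)%:R <=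
    c * \sum_x `|l1_map R p x - l1_map R q x| <= D * (word_dist p q)%:R].
Proof.
exists 1024, 14336; split; [exact: ler0n|by rewrite ltr1n|].
by move=> n p q; exact: l1_map_dist.
Qed.

(** * The noise operator on the cube *)

Section Mean.
Context (R : realType) (T : finType).
Implicit Types (g h : T -> R).

Definition mean g : R := #|T|%:R^-1 * \sum_t g t.

Lemma mean_le g h : (forall t, g t <= h t) -> mean g <= mean h.
Proof. by move=> gh; rewrite ler_wpM2l ?invr_ge0 ?ler0n // ler_sum. Qed.

Lemma meanD g h : mean (fun t => g t + h t) = mean g + mean h.
Proof. by rewrite /mean big_split mulrDr. Qed.

Lemma meanZ c g : mean (fun t => c * g t) = c * mean g.
Proof. by rewrite /mean -mulr_sumr mulrCA. Qed.

Lemma mean_reindex (s : T -> T) g : injective s -> mean (g \o s) = mean g.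
Proof. by move=> si; rewrite /mean [in RHS](reindex_inj si). Qed.

Lemma mean_sum (I : finType) (G : I -> T -> R) :
  mean (fun t => \sum_i G i t) = \sum_i mean (G i).
Proof. by rewrite /mean exchange_big mulr_sumr. Qed.

Lemma mean_cst c : (0 < #|T|)%N -> mean (fun=> c) = c.
Proof.
move=> T0; rewrite /mean sumr_const -[c *+ _]mulr_natr mulrCA mulVf ?mulr1 //.
by rewrite pnatr_eq0 -lt0n.
Qed.

Lemma eq_mean g h : g =1 h -> mean g = mean h.
Proof. by move=> gh; congr (_ * _); apply: eq_bigr. Qed.
End Mean.

Lemma card_cube (I : finType) : #|{ffun I -> bool}| = (2 ^ #|I|)%N.
Proof. by rewrite card_ffun card_bool. Qed.

Lemma card_cube_gt0 (I : finType) : (0 < #|{ffun I -> bool}|)%N.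
Proof. by rewrite card_cube expn_gt0. Qed.

Section PolyTaylor.
Context (R : realType).

Lemma poly_bounded (p : {poly R}) : exists2 B, 0 <= B &
  forall s, 0 <= s <= 1 -> `|p.[s]| <= B.
Proof.
exists (\sum_(i < size p) `|p`_i|); first exact: sumr_ge0.
move=> s /andP[s0 s1]; rewrite horner_coef.
apply: le_trans (ler_norm_sum _ _ _) _; apply: ler_sum => i _.
by rewrite normrM ler_piMr // ger0_norm ?exprn_ge0 // exprn_ile1.
Qed.

(** The remainder is uniform in [s] and [h]. Differentiating the polynomial weights of the noise
    operator then suffices, and no derivative of a vector-valued map is taken. *)
Lemma poly_taylor2 (p : {poly R}) : exists2 K, 0 <= K &
  forall s h, 0 <= s -> 0 <= h -> s + h <= 1 ->
  `|p.[s + h] - p.[s] - h * p^`().[s]| <= K * h ^+ 2.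
Proof.
elim/poly_ind: p => [|p c [K K0 HK]].
  by exists 0 => // s h _ _ _; rewrite deriv0 !horner0 mulr0 !subr0 normr0 mul0r.
have [B B0 HB] := poly_bounded p^`().
exists (K + B); first exact: addr_ge0.
move=> s h s0 h0 sh; rewrite derivD derivC addr0 derivM derivX mulr1 !(hornerD, hornerM, hornerX, hornerC).
have -> : p.[s + h] * (s + h) + c - (p.[s] * s + c) - h * (p^`().[s] * s + p.[s])
  = (s + h) * (p.[s + h] - p.[s] - h * p^`().[s]) + h ^+ 2 * p^`().[s] by ring.
apply: le_trans (ler_normD _ _) _; rewrite (mulrDl K B) (normrM (s + h)) (normrM (h ^+ 2)).
have h2 : `|h ^+ 2| = h ^+ 2 by rewrite ger0_norm ?exprn_ge0.
apply: lerD.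
  apply: le_trans (HK s h s0 h0 sh); rewrite ler_piMl // ger0_norm //.
  exact: addr_ge0.
by rewrite h2 mulrC ler_wpM2r ?exprn_ge0 // HB // s0 (le_trans _ sh) // lerDl.
Qed.

End PolyTaylor.

(** [D s t] stands for the distance between two points of a curve. Over equal steps the linear terms
    add up to M (b - a), and the quadratic errors to C (b - a)^2 divided by the number of steps. *)
Lemma mean_value_ineq (R : realType) (D : R -> R -> R) (a b M C : R) :
  a <= b -> 0 <= C -> (forall s, D s s <= 0) ->
  (forall s t u, D s u <= D s t + D t u) ->
  (forall s h, a <= s -> 0 <= h -> s + h <= b -> D s (s + h) <= M * h + C * h ^+ 2) ->
  D a b <= M * (b - a).
Proof.
move=> ab C0 D0 DT Dh; apply/ler_addgt0Pr => e e0.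
have ba0 : 0 <= b - a by rewrite subr_ge0.
pose n := Num.bound (C * (b - a) ^+ 2 / e).
have n0 : 0 < n.+1%:R :> R by rewrite ltr0n.
have nP : C * (b - a) ^+ 2 / e < n.+1%:R.
  have q0 : 0 <= C * (b - a) ^+ 2 / e.
    by rewrite divr_ge0 ?(ltW e0) // mulr_ge0 // exprn_ge0.
  by apply: lt_le_trans (archi_boundP q0) _; rewrite ler_nat leqnSn.
pose h := (b - a) / n.+1%:R; have h0 : 0 <= h by rewrite divr_ge0 // ltW.
have nh : n.+1%:R * h = b - a by rewrite mulrC divfK // gt_eqF.
have step k : (k <= n.+1)%N -> D a (a + k%:R * h) <= k%:R * (M * h + C * h ^+ 2).
  elim: k => [|k IH] kn; first by rewrite !mul0r addr0.
  apply: le_trans (DT _ (a + k%:R * h) _) _.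
  rewrite -natr1 !mulrDl !mul1r addrA; apply: lerD; first exact/IH/ltnW.
  apply: Dh => //; first by rewrite lerDl mulr_ge0.
  rewrite -addrA -{2}[h]mul1r -mulrDl natr1 -lerBrDl -nh ler_wpM2r //.
  by rewrite ler_nat.
have := step n.+1 (leqnn _); rewrite nh addrC subrK => /le_trans; apply.
rewrite mulrDr mulrCA nh lerD2l mulrCA expr2 (mulrA n.+1%:R) nh.
rewrite /h (mulrA (b - a)) -expr2 mulrA.
by rewrite ler_pdivrMr // [e * _]mulrC -ler_pdivrMr // ltW.
Qed.

Section Noise.
Context (R : realType) (X : normedModType R) (m : nat).
Local Notation I := 'I_m.
Local Notation B := {ffun I -> bool}.
Implicit Types (x y xi eta : B) (s : R) (f : B -> X) (v : I -> X).

Definition xorf x y : B := [ffun i => x i (+) y i].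
Definition flip (j : I) x : B := [ffun i => x i (+) (i == j)].
Definition negf x : B := [ffun i => ~~ x i].

Lemma xorf_inj x : injective (xorf x).
Proof.
move=> y z /ffunP e; apply/ffunP => i.
by have := e i; rewrite !ffunE => /addbI.
Qed.

Lemma xorfC x y : xorf x y = xorf y x.
Proof. by apply/ffunP => i; rewrite !ffunE addbC. Qed.

Lemma flipK j : involutive (flip j).
Proof. by move=> x; apply/ffunP => i; rewrite !ffunE addbK. Qed.

Lemma flip_xorf j x y : flip j (xorf x y) = xorf x (flip j y).
Proof. by apply/ffunP => i; rewrite !ffunE addbA. Qed.

Lemma negf_inj : injective negf.
Proof. by apply: (can_inj (g := negf)) => x; apply/ffunP => i; rewrite !ffunE negbK. Qed.

(** The probability of [xi] when each coordinate is flipped independently with probability [s]. Thus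
    [noise s f] leads from [f] at s = 0 to the constant mean of [f] at s = 1/2. *)
Definition weight s xi : R := \prod_j (if xi j then s else 1 - s).

Lemma weight_ge0 s xi : 0 <= s <= 1 -> 0 <= weight s xi.
Proof. by move=> /andP[s0 s1]; apply: prodr_ge0 => j _; case: ifP; rewrite ?subr_ge0. Qed.

Lemma sum_weight s : \sum_xi weight s xi = 1.
Proof.
rewrite -(bigA_distr_bigA (fun _ (b : bool) => if b then s else 1 - s)) /=.
by apply: big1 => j _; rewrite big_bool /= addrC subrK.
Qed.

Lemma weight_flip s j xi : weight s (flip j xi) * ((flip j xi j)%:R - s)
  = - (weight s xi * ((xi j)%:R - s)).
Proof.
rewrite /weight (bigD1 j) //= [in RHS](bigD1 j) //= !ffunE eqxx addbT.
rewrite (eq_bigr (fun i => if xi i then s else 1 - s)); last first.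
  by move=> i /negbTE ij; rewrite ffunE ij addbF.
by case: (xi j) => /=; ring.
Qed.

Lemma sum_weight_coord s j : \sum_xi weight s xi * ((xi j)%:R - s) = 0.
Proof.
set S := \sum_xi _; suff : S = - S by move/eqP; rewrite -addr_eq0 -mulr2n mulrn_eq0 => /eqP.
rewrite {1}/S (reindex_inj (inv_inj (flipK j))) /= -sumrN.
by apply: eq_bigr => xi _; rewrite weight_flip.
Qed.

Definition noise s f x : X := \sum_xi weight s xi *: f (xorf x xi).

Definition half_diff f (j : I) x : X := 2^-1 *: (f x - f (flip j x)).

(** The coefficient is odd under flipping coordinate [j] of [xi], so only the part of [f] that is
    odd in that coordinate survives. *)
Lemma sum_weight_half_diff s f j x :
  \sum_xi (weight s xi * ((xi j)%:R - s)) *: f (xorf x xi) =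
  \sum_xi (weight s xi * ((xi j)%:R - s)) *: half_diff f j (xorf x xi).
Proof.
set A := LHS.
have B : \sum_xi (weight s xi * ((xi j)%:R - s)) *: f (flip j (xorf x xi)) = - A.
  rewrite (reindex_inj (inv_inj (flipK j))) /= -sumrN; apply: eq_bigr => xi _.
  by rewrite weight_flip flip_xorf flipK scaleNr.
transitivity (2^-1 *: (A - - A)).
  by rewrite opprK -mulr2n -[A *+ 2]scaler_nat scalerA mulVf ?scale1r // pnatr_eq0.
rewrite -B /A -sumrB scaler_sumr; apply: eq_bigr => xi _.
by rewrite /half_diff -scalerBr !scalerA mulrC.
Qed.

Definition weight_poly xi : {poly R} := \prod_j (if xi j then 'X else 1 - 'X).

Lemma weight_polyE xi s : (weight_poly xi).[s] = weight s xi.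
Proof.
rewrite horner_prod; apply: eq_bigr => j _.
by case: (xi j); rewrite !hornerE.
Qed.

(** Logarithmic derivative: the factor at [j] contributes 1 / s or - 1 / (1 - s), which in both
    cases is (xi j - s) / (s (1 - s)). *)
Lemma weight_poly_deriv xi s : 0 < s < 1 -> (weight_poly xi)^`().[s] =
  (s * (1 - s))^-1 * (weight s xi * \sum_j ((xi j)%:R - s)).
Proof.
move=> /andP[s0 s1]; rewrite -weight_polyE /weight_poly.
have s10 : 1 - s != 0 by rewrite subr_eq0 gt_eqF.
elim/big_rec2: _ => [|j p q _ IH]; first by rewrite derivC horner0 !mulr0.
rewrite derivM hornerD !hornerM IH.
by case: (xi j); rewrite !(derivX, derivB, derivC, hornerE) /=; field;
  rewrite s10 gt_eqF.
Qed.

(* Interchanging [xi j] and [eta j] wherever [e j] holds preserves the product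
   weight and changes the sign of [xi j - eta j]; averaging over [e] brings in
   independent signs. *)
Lemma weight_symmetrization s v G : 0 <= s <= 1 ->
  (forall c : I -> R, (forall j, `|c j| <= 1) ->
     mean (fun e : B => `|\sum_j (-1) ^+ e j *: (c j *: v j)|) <= G) ->
  \sum_xi weight s xi * `|\sum_j ((xi j)%:R - s) *: v j| <= G.
Proof.
move=> s01 HG.
pose W (z : B * B) := weight s z.1 * weight s z.2.
pose c (z : B * B) j : R := (z.1 j)%:R - (z.2 j)%:R.
have W0 z : 0 <= W z by rewrite mulr_ge0 ?weight_ge0.
apply: (@le_trans _ _ (\sum_z W z * `|\sum_j c z j *: v j|)).
  rewrite -(pair_bigA _ (fun xi eta => W (xi, eta) *
    `|\sum_j c (xi, eta) j *: v j|)) /=.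
  apply: ler_sum => xi _; rewrite /W /=.
  under [leRHS]eq_bigr do rewrite -mulrA; rewrite -mulr_sumr.
  rewrite ler_wpM2l ?weight_ge0 //.
  (* Each [eta j] has mean [s], so the centred sum is an average over an independent copy [eta], and
     convexity of the norm applies. *)
  have -> : \sum_j ((xi j)%:R - s) *: v j =
      \sum_eta weight s eta *: \sum_j c (xi, eta) j *: v j.
    under [RHS]eq_bigr do rewrite scaler_sumr.
    rewrite exchange_big; apply: eq_bigr => j _ /=.
    under eq_bigr do rewrite scalerA; rewrite -scaler_suml; congr (_ *: _).
    have := sum_weight_coord s j; have := sum_weight s => H1 H2.
    transitivity (\sum_eta (weight s eta * ((xi j)%:R - s)
      - weight s eta * ((eta j)%:R - s))).
      by rewrite sumrB H2 subr0 -mulr_suml H1 mul1r.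
    by apply: eq_bigr => eta _; rewrite /c /=; ring.
  apply: le_trans (ler_norm_sum _ _ _) _; apply: ler_sum => eta _.
  by rewrite normrZ ger0_norm ?weight_ge0.
have sym (e : B) : \sum_z W z * `|\sum_j c z j *: v j| =
    \sum_z W z * `|\sum_j (-1) ^+ e j *: (c z j *: v j)|.
  pose sw (z : B * B) : B * B :=
    ([ffun j => if e j then z.2 j else z.1 j],
     [ffun j => if e j then z.1 j else z.2 j]).
  have swK : involutive sw.
    by move=> [a b]; congr (_, _); apply/ffunP => j; rewrite !ffunE; case: (e j).
  rewrite (reindex_inj (inv_inj swK)) /=; apply: eq_bigr => z _.
  have WE : W (sw z) = W z.
    rewrite /W /weight -!big_split; apply: eq_bigr => j _ /=.
    by rewrite !ffunE; case: (e j); rewrite // mulrC.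
  rewrite -/(sw z) WE; congr (_ * _); congr (Num.norm _); apply: eq_bigr => j _.
  rewrite /c /= !ffunE scalerA; congr (_ *: _).
  by case: (e j); rewrite ?expr1 ?expr0 ?mul1r // mulN1r opprB.
have -> : \sum_z W z * `|\sum_j c z j *: v j| =
    \sum_z W z * mean (fun e : B => `|\sum_j (-1) ^+ e j *: (c z j *: v j)|).
  rewrite -[LHS](mean_cst _ (card_cube_gt0 I)) (eq_mean sym) mean_sum.
  by apply: eq_bigr => z _; rewrite meanZ.
have -> : G = \sum_z W z * G.
  rewrite -mulr_suml -(pair_bigA _ (fun a b => weight s a * weight s b)) /=.
  under eq_bigr do rewrite -mulr_sumr sum_weight mulr1.
  by rewrite sum_weight mul1r.
apply: ler_sum => z _; rewrite ler_wpM2l // HG // => j.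
by rewrite /c; do 2 case: (_ j); rewrite ?subrr ?subr0 ?sub0r ?normrN ?normr0 ?normr1.
Qed.

Lemma noise_deriv_bound s f G : 0 < s < 1 ->
  (forall x (c : I -> R), (forall j, `|c j| <= 1) ->
     mean (fun e : B => `|\sum_j (-1) ^+ e j *: (c j *: half_diff f j x)|) <= G) ->
  mean (fun x => `|\sum_xi (weight_poly xi)^`().[s] *: f (xorf x xi)|) <=
    (s * (1 - s))^-1 * G.
Proof.
move=> s01 HG; have /andP[s0 s1] := s01.
have s01' : 0 <= s <= 1 by rewrite !ltW.
have ss0 : 0 <= (s * (1 - s))^-1 by rewrite invr_ge0 mulr_ge0 ?subr_ge0 ?ltW.
have E x : `|\sum_xi (weight_poly xi)^`().[s] *: f (xorf x xi)| =
  (s * (1 - s))^-1 *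
  `|\sum_xi weight s xi *: \sum_j ((xi j)%:R - s) *: half_diff f j (xorf x xi)|.
  rewrite -[X in X * `|_|](ger0_norm ss0) -normrZ; congr (Num.norm _).
  under eq_bigr do rewrite weight_poly_deriv // -scalerA mulr_sumr scaler_suml.
  rewrite -scaler_sumr; congr (_ *: _).
  rewrite exchange_big /=; under eq_bigr do rewrite sum_weight_half_diff.
  rewrite exchange_big /=; apply: eq_bigr => xi _; rewrite scaler_sumr.
  by apply: eq_bigr => j _; rewrite [RHS]scalerA.
rewrite (eq_mean E) meanZ ler_wpM2l //.
apply: (@le_trans _ _ (mean (fun x => \sum_xi weight s xi *
   `|\sum_j ((xi j)%:R - s) *: half_diff f j (xorf x xi)|))).
  apply: mean_le => x; apply: le_trans (ler_norm_sum _ _ _) _.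
  by apply: ler_sum => xi _; rewrite normrZ ger0_norm ?weight_ge0.
rewrite mean_sum.
have -> : \sum_xi mean (fun x => weight s xi *
     `|\sum_j ((xi j)%:R - s) *: half_diff f j (xorf x xi)|) =
   mean (fun x => \sum_xi weight s xi * `|\sum_j ((xi j)%:R - s) *: half_diff f j x|).
  rewrite mean_sum; apply: eq_bigr => xi _.
  (* For fixed [xi], [xorf x xi] is uniform like [x]. After this change of variables the vectors
     [half_diff f j x] no longer depend on [xi], as the symmetrization requires. *)
  rewrite -[RHS](mean_reindex (s := xorf xi)); last exact: xorf_inj.
  by apply: eq_mean => x /=; rewrite xorfC.
rewrite -(mean_cst G (card_cube_gt0 I)); apply: mean_le => x.
by apply: weight_symmetrization => // c; apply: HG.
Qed.

End Noise.

(** * Pisier's inequality on the cube under type p *)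

Section CubeInequality.
Context (R : realType) (X : normedModType R).

Lemma type_mean p : rademacher_type X p -> exists2 A : R, 0 <= A &
  forall m (v : 'I_m -> X) (L : R), (0 < m)%N -> 0 < L -> (forall j, `|v j| <= L) ->
  mean (fun e : {ffun 'I_m -> bool} => `|\sum_j (-1) ^+ e j *: v j|)
    <= A * (m%:R `^ p^-1 * L).
Proof.
case=> /andP[p1 _] [T T0 HT]; exists (1 + T `^ p); first by rewrite addr_ge0 ?powR_ge0.
move=> m v L m0 L0 vL; have p0 : 0 < p by apply: lt_le_trans p1.
set s := m%:R `^ p^-1 * L.
have mp0 : 0 < m%:R `^ p^-1 :> R by rewrite powR_gt0 // ltr0n.
have s0 : 0 < s by rewrite mulr_gt0.
have sp : s `^ p = m%:R * L `^ p.
  rewrite powRM ?ltW // -powRrM mulVf ?gt_eqF // powRr1 //; exact: ler0n.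
have sp0 : 0 < s `^ p by rewrite powR_gt0.
(* A linear bound for the first moment by the p-th moment; [s] is chosen with s^p = m L^p, so that
   type p turns the second term into a multiple of [s]. *)
have pt (a : R) : 0 <= a -> a <= s + s / s `^ p * a `^ p.
  move=> a0; have [as_|sa] := leP a s.
    by apply: (le_trans as_); rewrite lerDl !mulr_ge0 ?invr_ge0 ?powR_ge0 // ltW.
  have a_gt0 : 0 < a := lt_trans s0 sa.
  have split (b : R) : 0 < b -> b `^ p = b * b `^ (p - 1).
    move=> b0; have e : p = 1 + (p - 1) by rewrite addrC subrK.
    rewrite [in LHS]e (@powRD _ b 1 (p - 1)); last by rewrite (gt_eqF b0) implybT.
    by rewrite (powRr1 (ltW b0)).
  have : a <= s / s `^ p * a `^ p.
    rewrite mulrAC ler_pdivlMr // (split _ s0) (split _ a_gt0) mulrCA.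
    apply: ler_wpM2l; first exact: ltW.
    apply: ler_wpM2l; first exact: ltW.
    by apply: ge0_ler_powR; rewrite ?nnegrE ?subr_ge0 // ltW.
  by move=> /le_trans; apply; rewrite lerDr; exact: ltW.
apply: le_trans (_ : mean (fun e : {ffun 'I_m -> bool} => s + s / s `^ p *
    `|\sum_j (-1) ^+ e j *: v j| `^ p) <= _); first by apply: mean_le => e; apply: pt.
rewrite meanD mean_cst ?card_cube_gt0 // meanZ mulrDl mul1r lerD2l.
have -> : mean (fun e : {ffun 'I_m -> bool} => `|\sum_j (-1) ^+ e j *: v j| `^ p)
    = rademacher_mean p v.
  by rewrite /mean /rademacher_mean card_cube card_ord natrX.
apply: (@le_trans _ _ (s / s `^ p * (T `^ p * (m%:R * L `^ p)))).
  apply: ler_wpM2l; first by rewrite divr_ge0 ?ltW.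
  apply: le_trans (HT m v) _; apply: ler_wpM2l; first exact: powR_ge0.
  rewrite -[m in m%:R]card_ord -sum1_card natr_sum mulr_suml.
  apply: ler_sum => j _; by rewrite mul1r ge0_ler_powR ?nnegrE ?(ltW p0) ?(ltW L0).
rewrite -sp; move: (s `^ p) (T `^ p) sp0 => S Tp S0.
have -> // : s / S * (Tp * S) = Tp * s by field; rewrite gt_eqF.
Qed.

Section NoiseDistance.
Context (m : nat) (f : {ffun 'I_m -> bool} -> X) (L : R).
Context (fL : forall x j, `|f x - f (flip j x)| <= L).
Local Notation B := {ffun 'I_m -> bool}.

Definition noise_dist (s t : R) : R := mean (fun x : B => `|noise s f x - noise t f x|).

Lemma noise_dist_triangle t s u : noise_dist s u <= noise_dist s t + noise_dist t u.
Proof. by rewrite /noise_dist -meanD; apply: mean_le => x; exact: ler_distD. Qed.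

(** On [a, b] one has s >= a and 1 - s >= 1/2, so the derivative is at most 2 G / a in mean; [C]
    collects the Taylor remainders of all the weights. *)
Lemma noise_dist_mid G a b : 0 < a -> a <= b -> b <= 2^-1 -> 0 <= G ->
  (forall x (c : 'I_m -> R), (forall j, `|c j| <= 1) ->
     mean (fun e : B => `|\sum_j (-1) ^+ e j *: (c j *: half_diff f j x)|) <= G) ->
  noise_dist a b <= 2 / a * G * (b - a).
Proof.
move=> a0 ab b2 G0 HG.
have /choice[K HK] : forall xi : B, exists K, 0 <= K /\
    forall s h, 0 <= s -> 0 <= h -> s + h <= 1 -> `|(weight_poly R xi).[s + h]
      - (weight_poly R xi).[s] - h * (weight_poly R xi)^`().[s]| <= K * h ^+ 2.
  by move=> xi; have [K K0 HK] := poly_taylor2 (weight_poly R xi); exists K.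
pose C := mean (fun x : B => \sum_xi K xi * `|f (xorf x xi)|).
apply: (mean_value_ineq (C := C)) => //.
- rewrite /C -[leLHS](mean_cst 0 (card_cube_gt0 'I_m)); apply: mean_le => x.
  by apply: sumr_ge0 => xi _; rewrite mulr_ge0 //; case: (HK xi).
- move=> s; rewrite /noise_dist -[leRHS](mean_cst 0 (card_cube_gt0 'I_m)).
  by apply: mean_le => x; rewrite subrr normr0.
- by move=> s t u; exact: noise_dist_triangle.
move=> s h as_ h0 shb; have s0 : 0 < s by apply: lt_le_trans as_.
have sb : s <= b by apply: le_trans shb; rewrite lerDl.
have s2 : s <= 2^-1 by apply: le_trans b2.
have s1 : 0 < s < 1 by rewrite s0 /= (le_lt_trans s2) // invf_lt1 ?ltr1n ?ltr0n.
pose dF x := \sum_xi (weight_poly R xi)^`().[s] *: f (xorf x xi).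
have bound : mean (fun x : B => `|dF x|) <= 2 / a * G.
  apply: le_trans (noise_deriv_bound s1 HG) _; apply: ler_wpM2r => //.
  rewrite -[2 / a]invf_div lef_pV2 ?posrE ?divr_gt0 ?mulr_gt0 ?subr_gt0 //; last first.
    by case/andP: s1.
  by apply: ler_pM => //; lra.
apply: (@le_trans _ _ (mean (fun x : B =>
    h * `|dF x| + h ^+ 2 * \sum_xi K xi * `|f (xorf x xi)|))).
  apply: mean_le => x; rewrite distrC.
  have -> : noise (s + h) f x - noise s f x = h *: dF x + \sum_xi
     ((weight_poly R xi).[s + h] - (weight_poly R xi).[s]
       - h * (weight_poly R xi)^`().[s]) *: f (xorf x xi).
    rewrite /noise /dF scaler_sumr -sumrB -big_split /=; apply: eq_bigr => xi _.
    by rewrite !weight_polyE scalerA -scalerDl -scalerBl; congr (_ *: _); ring.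
  apply: le_trans (ler_normD _ _) _; rewrite normrZ (ger0_norm h0) lerD2l.
  apply: le_trans (ler_norm_sum _ _ _) _; rewrite mulr_sumr; apply: ler_sum => xi _.
  rewrite normrZ mulrA [_ * K xi]mulrC ler_wpM2r //; case: (HK xi) => _; apply=> //.
    exact: ltW.
  by apply: (le_trans shb); apply: (le_trans b2); rewrite invf_le1 ?ler1n ?ltr0n.
rewrite meanD !meanZ -/C [h * _]mulrC [_ * C]mulrC lerD2r.
exact: ler_wpM2r.
Qed.

(** The derivative bound blows up like 1/s at 0, so small [s] is treated directly: [xi] flips m s
    coordinates on average, and flipping them one at a time costs at most [L] each. *)
Lemma noise_dist_start s : 0 <= s <= 1 ->
  mean (fun x : B => `|f x - noise s f x|) <= L * (m%:R * s).
Proof.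
move=> s01.
have path x (xi : B) : `|f x - f (xorf x xi)| <= \sum_(j < m) L * (xi j)%:R.
  pose z (r : seq 'I_m) : B := [ffun i => x i (+) (xi i && (i \in r))].
  have H r : uniq r -> `|f x - f (z r)| <= \sum_(j <- r) L * (xi j)%:R.
    elim: r => [|j r IH] /=.
      move=> _; rewrite big_nil (_ : z [::] = x) ?subrr ?normr0 //.
      by apply/ffunP => i; rewrite ffunE in_nil andbF addbF.
    move=> /andP[jr /IH {}IH]; rewrite big_cons [leRHS]addrC.
    apply: le_trans (ler_distD (f (z r)) _ _) _; apply: lerD => //.
    have [xj|xj] := boolP (xi j); last first.
      rewrite mulr0 (_ : z (j :: r) = z r) ?subrr ?normr0 //.
      apply/ffunP => i; rewrite !ffunE in_cons; have [->|//] := eqVneq i j.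
      by rewrite (negbTE xj).
    rewrite mulr1 (_ : z (j :: r) = flip j (z r)) //.
    apply/ffunP => i; rewrite !ffunE in_cons; have [->|_] := eqVneq i j.
      by rewrite xj (negbTE jr) addbF.
    by rewrite addbF.
  have := H (enum 'I_m) (enum_uniq _); rewrite big_enum /=.
  rewrite (_ : z _ = xorf x xi) //.
  by apply/ffunP => i; rewrite !ffunE mem_enum andbT.
have -> : L * (m%:R * s) = mean (fun x : B => \sum_(xi : B) weight s xi *
    \sum_(j < m) L * (xi j)%:R).
  rewrite mean_cst ?card_cube_gt0 //.
  under eq_bigr do rewrite mulr_sumr; rewrite exchange_big /=.
  rewrite -[m in m%:R]card_ord -sum1_card natr_sum mulr_suml mulr_sumr.
  apply: eq_bigr => j _; rewrite mul1r.
  have : \sum_(xi : B) weight s xi * (xi j)%:R - \sum_(xi : B) weight s xi * s = 0.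
    by rewrite -sumrB -[RHS](sum_weight_coord s j); apply: eq_bigr => xi _; ring.
  rewrite -mulr_suml sum_weight mul1r => /subr0_eq e.
  by rewrite -[in LHS]e mulr_sumr; apply: eq_bigr => xi _; ring.
apply: mean_le => x.
have -> : f x - noise s f x = \sum_xi weight s xi *: (f x - f (xorf x xi)).
  under eq_bigr do rewrite scalerBr.
  by rewrite sumrB -scaler_suml sum_weight scale1r.
apply: le_trans (ler_norm_sum _ _ _) _; apply: ler_sum => xi _.
by rewrite normrZ ger0_norm ?weight_ge0 // ler_wpM2l ?weight_ge0.
Qed.

Lemma noise_half x y : noise 2^-1 f x = noise 2^-1 f y.
Proof.
have H z : noise 2^-1 f z = \sum_(xi : B) (2^-1 ^+ m) *: f xi.
  rewrite /noise [RHS](reindex_inj (@xorf_inj _ z)) /=; apply: eq_bigr => xi _.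
  congr (_ *: _); rewrite /weight -[X in _ ^+ X]card_ord -prodr_const.
  by apply: eq_bigr => j _; case: (xi j) => //; lra.
by rewrite !H.
Qed.

End NoiseDistance.

(** The interval up to 1/2 is cut at the dyadic points 2^-(k+1). Each dyadic piece costs 2 G, there
    are K = log_2 m of them, and the initial piece costs L / 2 because m s = 1/2 there. At s = 1/2
    the noise of [f] is constant, so the triangle inequality at [x] and [negf x] doubles the
    total. *)
Lemma type_cube_bound p : rademacher_type X p -> exists2 A : R, 0 <= A &
  forall K (m := (2 ^ K)%N) (f : {ffun 'I_m -> bool} -> X) (L r : R), 0 < L ->
  (forall x j, `|f x - f (flip j x)| <= L) ->
  (forall x, r <= `|f x - f (negf x)|) ->
  r <= L * (1 + 4 * (K%:R * (A * m%:R `^ p^-1))).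
Proof.
move=> /type_mean[A A0 HA]; exists A => // K m f L r L0 fL rf.
have m0 : (0 < m)%N by rewrite expn_gt0.
pose G := A * (m%:R `^ p^-1 * L).
have G0 : 0 <= G by rewrite !mulr_ge0 ?powR_ge0 // ltW.
have HG x (c : 'I_m -> R) : (forall j, `|c j| <= 1) ->
     mean (fun e : {ffun 'I_m -> bool} =>
       `|\sum_j (-1) ^+ e j *: (c j *: half_diff f j x)|) <= G.
  move=> c1; apply: HA => // j; rewrite normrZ -[leRHS]mul1r ler_pM //.
  rewrite normrZ -[leRHS]mul1r ler_pM // ger0_norm ?invr_ge0 //.
  by rewrite invf_le1 ?ler1n ?ltr0n.
pose s k : R := 2^-1 ^+ k.+1.
have s_gt0 k : 0 < s k by rewrite exprn_gt0 // invr_gt0.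
have sS k : s k = 2 * s k.+1 by rewrite /s [in RHS]exprS mulrA mulfV ?mul1r // pnatr_eq0.
have s_half k : s k <= 2^-1.
  by rewrite /s exprS ler_piMr ?invr_ge0 // exprn_ile1 ?invr_ge0 // invf_le1 ?ler1n ?ltr0n.
have dyadic k : noise_dist f (s k) 2^-1 <= 2 * (k%:R * G).
  elim: k => [|k IH].
    rewrite /s expr1 /noise_dist mul0r mulr0 -[leRHS](mean_cst 0 (card_cube_gt0 'I_m)).
    by apply: mean_le => x; rewrite subrr normr0.
  apply: le_trans (noise_dist_triangle f (s k) _ _) _.
  have -> : 2 * (k.+1%:R * G) = 2 * G + 2 * (k%:R * G) by rewrite -[k.+1%:R]natr1; ring.
  rewrite lerD //.
  have -> : 2 * G = 2 / s k.+1 * G * (s k - s k.+1).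
    by rewrite [s k]sS; field; rewrite gt_eqF.
  apply: (noise_dist_mid (s_gt0 k.+1) _ (s_half k) G0 HG).
  by rewrite [s k]sS; have := s_gt0 k.+1; lra.
have mid : mean (fun x => `|f x - noise 2^-1 f x|) <= L * 2^-1 + 2 * (K%:R * G).
  apply: (@le_trans _ _ (mean (fun x => `|f x - noise (s K) f x|) + noise_dist f (s K) 2^-1)).
    by rewrite -meanD; apply: mean_le => x; exact: ler_distD.
  apply: lerD => //; apply: le_trans (noise_dist_start fL _) _.
    by rewrite ltW //= (le_trans (s_half K)) // invf_le1 ?ler1n ?ltr0n.
  have -> // : m%:R * s K = 2^-1.
  rewrite /s exprS mulrCA /m natrX -[_ * 2^-1 ^+ K]exprMn mulfV ?pnatr_eq0 //.
  by rewrite expr1n mulr1.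
have : r <= 2 * (L * 2^-1 + 2 * (K%:R * G)).
  rewrite -(mean_cst r (card_cube_gt0 'I_m)).
  apply: (@le_trans _ _ (mean (fun x => `|f x - noise 2^-1 f x|) +
      mean (fun x => `|f (negf x) - noise 2^-1 f (negf x)|))).
    rewrite -meanD; apply: mean_le => x; apply: (le_trans (rf x)).
    rewrite [X in _ <= _ + X]distrC (noise_half _ (negf x) x).
    exact: ler_distD.
  have := mean_reindex (fun x => `|f x - noise 2^-1 f x|) (@negf_inj m).
  by rewrite /comp => ->; lra.
move=> /le_trans; apply; rewrite /G.
move: (K%:R) (_ `^ _) => k y; lra.
Qed.

End CubeInequality.

(** * Trivial type and copies of l_1^n *)

Section SignInequality.
Context (R : realType) (X : normedModType R).

(** A type 2 inequality for a fixed number of vectors. The constant #|J| always works, by the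
    triangle and Cauchy-Schwarz inequalities; the information lies in a smaller one. *)
Definition sign_ineq (J : finType) (c : R) := forall y : J -> X,
  mean (fun e : {ffun J -> bool} => `|\sum_j (-1) ^+ e j *: y j| ^+ 2)
    <= c * \sum_j `|y j| ^+ 2.

(** Multiplying uniform signs by further independent signs, constant on the fibres of [phi],
    preserves their law. With [e] fixed, the signs [z] are those of an inequality indexed by [J]. *)
Lemma mean_flip (I J : finType) (phi : I -> J) (G : {ffun I -> bool} -> R) :
  mean G = mean (fun e : {ffun I -> bool} => mean (fun z : {ffun J -> bool} =>
    G [ffun i => e i (+) z (phi i)])).
Proof.
transitivity (mean (fun z : {ffun J -> bool} => mean (fun e : {ffun I -> bool} =>
    G [ffun i => e i (+) z (phi i)]))).
  rewrite -[LHS](mean_cst _ (card_cube_gt0 J)); apply: eq_mean => z.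
  rewrite -(mean_reindex (s := fun e : {ffun I -> bool} =>
    [ffun i => e i (+) z (phi i)])) //.
  move=> a b /ffunP ab; apply/ffunP => i; have := ab i.
  by rewrite !ffunE => /addIb.
by rewrite /mean -!mulr_sumr mulrCA exchange_big.
Qed.

Lemma sign_ineq_sub (I J : finType) (c : R) (A : pred I) (phi : I -> J) (x : I -> X) :
  sign_ineq J c -> 0 <= c -> {in A &, injective phi} ->
  mean (fun e : {ffun I -> bool} => `|\sum_(i | A i) (-1) ^+ e i *: x i| ^+ 2)
    <= c * \sum_(i | A i) `|x i| ^+ 2.
Proof.
move=> Jc c0 phi_inj; rewrite (mean_flip phi).
rewrite -[leRHS](mean_cst _ (card_cube_gt0 I)); apply: mean_le => e.
pose y j := \sum_(i | A i && (phi i == j)) (-1) ^+ e i *: x i.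
have E (z : {ffun J -> bool}) :
  `|\sum_(i | A i) (-1) ^+ [ffun i => e i (+) z (phi i)] i *: x i| ^+ 2
   = `|\sum_j (-1) ^+ z j *: y j| ^+ 2.
  congr (_ ^+ 2); congr (Num.norm _).
  rewrite (partition_big phi xpredT) //=; apply: eq_bigr => j _.
  rewrite scaler_sumr; apply: eq_bigr => i /andP[_ /eqP <-].
  by rewrite ffunE signr_addb mulrC scalerA.
rewrite (eq_mean E); apply: le_trans (Jc y) _; apply: ler_wpM2l => //.
rewrite [leRHS](partition_big phi xpredT) //=; apply: ler_sum => j _; rewrite /y.
have [i /andP[Ai /eqP ij]|none] := pickP (fun i => A i && (phi i == j)).
  have uniq_i k : A k && (phi k == j) = (k == i).
    apply/idP/eqP => [/andP[Ak /eqP kj]|->]; last by rewrite Ai ij eqxx.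
    by apply: phi_inj => //; rewrite kj ij.
  rewrite !(eq_bigl _ _ uniq_i) !big_pred1_eq normrZ.
  by rewrite normrX normrN1 expr1n mul1r.
by rewrite !big_pred0 // normr0 expr0n.
Qed.

(** With extra signs per row, the inequality for [I] applies to the row sums, and that for [J] then
    applies within each row. Iterated, this gives the constant c^k for n^k vectors. *)
Lemma sign_ineq_prod (I J : finType) (c d : R) : 0 <= c -> 0 <= d ->
  sign_ineq I c -> sign_ineq J d -> sign_ineq (I * J)%type (c * d).
Proof.
move=> c0 d0 Ic Jd y; rewrite (mean_flip fst).
pose Y (e : {ffun I * J -> bool}) i := \sum_(p | p.1 == i) (-1) ^+ e p *: y p.
apply: (@le_trans _ _ (mean (fun e => c * \sum_i `|Y e i| ^+ 2))).
  apply: mean_le => e; apply: le_trans (Ic (Y e)); rewrite le_eqVlt; apply/orP; left.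
  apply/eqP/eq_mean => z; congr (_ ^+ 2); congr (Num.norm _).
  rewrite (partition_big fst xpredT) //=; apply: eq_bigr => i _.
  rewrite scaler_sumr; apply: eq_bigr => p /eqP <-.
  by rewrite ffunE signr_addb mulrC scalerA.
rewrite meanZ mean_sum -mulrA ler_wpM2l // mulr_sumr.
rewrite [in leRHS](partition_big fst xpredT) //=; apply: ler_sum => i _.
rewrite -mulr_sumr; apply: (sign_ineq_sub (phi := snd)) => //.
by move=> [a b] [a' b'] /eqP /= -> /eqP /= -> ->.
Qed.

Lemma sign_ineq_exp (J : finType) (c : R) k : 0 <= c -> sign_ineq J c ->
  exists J' : finType, #|J'| = (#|J| ^ k)%N /\ sign_ineq J' (c ^+ k).
Proof.
move=> c0 Jc; elim: k => [|k [J' [cJ' IH]]].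
  exists unit; split; first by rewrite card_unit.
  move=> y; have sum1 (V : nmodType) (F : unit -> V) : \sum_j F j = F tt.
    by apply: big_pred1; case.
  rewrite expr0 mul1r sum1.
  rewrite -[leRHS](mean_cst _ (card_cube_gt0 unit)); apply: mean_le => e.
  rewrite sum1 normrZ.
  by rewrite normrX normrN1 expr1n mul1r.
exists (J * J')%type; split; first by rewrite card_prod cJ' expnS.
by rewrite exprS; apply: sign_ineq_prod => //; exact: exprn_ge0.
Qed.

Lemma weighted_cauchy_schwarz K (a w : nat -> R) : (forall k, 0 < w k) ->
  (\sum_(k < K) a k) ^+ 2 <= (\sum_(k < K) w k) * \sum_(k < K) (a k ^+ 2 / w k).
Proof.
move=> w0; elim: K => [|K IH]; first by rewrite !big_ord0 mul0r expr0n.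
rewrite !big_ord_recr /=.
have W0 : 0 <= \sum_(k < K) w k by apply: sumr_ge0 => k _; exact: ltW.
move: IH W0; set S := \sum_(k < K) a k; set W := \sum_(k < K) w k.
set Q := \sum_(k < K) _; move: (a K) (w K) (w0 K) => b u u0 SWQ.
have -> : (W + u) * (Q + b ^+ 2 / u) = W * Q + u * Q + W * b ^+ 2 / u + b ^+ 2.
  by field; rewrite gt_eqF.
rewrite le_eqVlt => /predU1P[W0|W0].
  have S0 : S = 0.
    by apply/eqP; rewrite -sqrf_eq0 eq_le sqr_ge0 andbT; move: SWQ; rewrite -W0 mul0r.
  rewrite S0 add0r -W0 !mul0r add0r addr0 lerDr mulr_ge0 ?(ltW u0) // /Q.
  by apply: sumr_ge0 => k _; rewrite divr_ge0 ?sqr_ge0 // ltW.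
have Q1 : S ^+ 2 / W <= Q by rewrite ler_pdivrMr // mulrC.
have A : 2 * S * b <= u * (S ^+ 2 / W) + W * b ^+ 2 / u.
  rewrite -subr_ge0.
  have -> : u * (S ^+ 2 / W) + W * b ^+ 2 / u - 2 * S * b
     = (u * S - W * b) ^+ 2 / (W * u) by field; rewrite !gt_eqF.
  by rewrite divr_ge0 ?sqr_ge0 // mulr_ge0 // ltW.
have B : u * (S ^+ 2 / W) <= u * Q by rewrite ler_wpM2l // ltW.
move: A B SWQ; move: (u * (_ / W)) (u * Q) (W * _ / u) (W * Q) => x1 x2 x3 x4.
rewrite sqrrD -mulr_natl; lra.
Qed.

Lemma geometric_le (q : R) K : 0 <= q < 1 -> \sum_(k < K) q ^+ k <= (1 - q)^-1.
Proof.
move=> /andP[q0 q1]; have q10 : 0 < 1 - q by rewrite subr_gt0.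
rewrite -[leRHS]mul1r ler_pdivlMr // mulrC.
have -> : (1 - q) * \sum_(k < K) q ^+ k = 1 - q ^+ K.
  by rewrite -opprB mulNr -subrX1 opprB.
by rewrite gerBl exprn_ge0.
Qed.

Lemma inj_in_card (I J : finType) (A : pred I) : (#|A| <= #|J|)%N -> (0 < #|J|)%N ->
  exists phi : I -> J, {in A &, injective phi}.
Proof.
move=> AJ /card_gt0P[j0 _]; exists (fun i => nth j0 (enum J) (index i (enum A))).
move=> i k Ai Ak; have lt l : l \in A -> (index l (enum A) < size (enum J))%N.
  by move=> Al; rewrite -cardE (leq_trans _ AJ) // cardE index_mem mem_enum.
move/eqP; rewrite nth_uniq ?enum_uniq ?lt // => /eqP e.
by rewrite -(nth_index i (_ : i \in enum A)) ?mem_enum // e nth_index ?mem_enum.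
Qed.

End SignInequality.

(** * From a sign inequality to Rademacher type *)

Section TypeFromSigns.
Context (R : realType) (X : normedModType R).

Lemma eq_le_refl (a b : R) : a = b -> a <= b.
Proof. by move=> ->. Qed.

(** By homogeneity it suffices to treat vectors whose p-th powers sum to 1, and a^p <= 1 + a^2
    passes from the second moment to the p-th. *)
Lemma rademacher_type_normalized (p C : R) : 1 <= p <= 2 -> 0 <= C ->
  (forall m (x : 'I_m -> X), \sum_i `|x i| `^ p = 1 ->
     mean (fun e : {ffun 'I_m -> bool} => `|\sum_i (-1) ^+ e i *: x i| ^+ 2) <= C) ->
  rademacher_type X p.
Proof.
move=> /andP[p1 p2] C0 HC; split; first by rewrite p1.
have p0 : 0 < p by apply: lt_le_trans p1.
exists ((1 + C) `^ p^-1); first exact: powR_ge0.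
move=> m x; rewrite -powRrM mulVf ?gt_eqF // powRr1 ?addr_ge0 //.
have meanE (y : 'I_m -> X) : rademacher_mean p y =
    mean (fun e : {ffun 'I_m -> bool} => `|\sum_i (-1) ^+ e i *: y i| `^ p).
  by rewrite /mean /rademacher_mean card_cube card_ord natrX.
set s := \sum_i _; have s0 : 0 <= s by apply: sumr_ge0 => i _; exact: powR_ge0.
have [s_eq0|s_neq0] := eqVneq s 0.
  have x0 i : x i = 0.
    have /eqP := s_eq0; rewrite psumr_eq0 => [|j _]; last exact: powR_ge0.
    move=> /allP /(_ i); rewrite mem_index_enum => /(_ isT).
    by rewrite powR_eq0 normr_eq0 => /andP[/eqP].
  rewrite meanE s_eq0 mulr0 -[leRHS](mean_cst _ (card_cube_gt0 'I_m)).
  apply: mean_le => e; rewrite big1 ?normr0 ?powR0 ?gt_eqF // => i _.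
  by rewrite x0 scaler0.
have {s_neq0} s_gt0 : 0 < s by rewrite lt_neqAle eq_sym s_neq0.
pose u := s `^ (- p^-1); have u0 : 0 < u by rewrite powR_gt0.
have up : u `^ p = s^-1.
  by rewrite /u -powRrM mulNr mulVf ?gt_eqF // powR_inv1.
have norm1 : \sum_i `|u *: x i| `^ p = 1.
  under eq_bigr do rewrite normrZ powRM // (gtr0_norm u0) up.
  by rewrite -mulr_sumr -/s mulVf ?gt_eqF.
have pt (a : R) : 0 <= a -> a `^ p <= 1 + a ^+ 2.
  move=> a0; have [a1|a1] := leP a 1.
    apply: (@le_trans _ _ 1); last by rewrite lerDl sqr_ge0.
    have <- : 1 `^ p = 1 :> R by rewrite powR1.
    by apply: ge0_ler_powR; rewrite ?nnegrE // ltW.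
  apply: (@le_trans _ _ (a `^ 2)); first by apply: ler_powR => //; exact: ltW.
  by rewrite (powR_mulrn 2) // lerDr.
have : s^-1 * rademacher_mean p x <= 1 + C.
  rewrite meanE -meanZ -[X in _ <= X + C](mean_cst 1 (card_cube_gt0 'I_m)).
  apply: le_trans (lerD (lexx _) (HC _ _ norm1)); rewrite -meanD.
  apply: mean_le => e; apply: le_trans (pt _ (normr_ge0 _)).
  rewrite -up -[X in X `^ p * _](gtr0_norm u0) -powRM // -normrZ scaler_sumr.
  apply: eq_le_refl; congr (_ `^ _); congr (Num.norm _).
  by apply: eq_bigr => i _; rewrite !scalerA mulrC.
by rewrite mulrC ler_pdivrMr.
Qed.

Lemma exists_small_power (t e : R) : 0 < t -> 0 < e -> exists k, expR (- t) ^+ k < e.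
Proof.
move=> t0 e0; pose k := Num.bound (`|ln e| / t); exists k.
rewrite -expRM_natl -[ltRHS](lnK (x := e)) ?posrE // ltr_expR mulrN ltrNl.
have : `|ln e| / t < k%:R by apply: archi_boundP; rewrite divr_ge0 // ltW.
rewrite ltr_pdivrMr //; apply: le_lt_trans.
by rewrite -normrN ler_norm.
Qed.

(* The vectors are sorted by size: those with theta^(k+1) < |x i| <= theta^k
   are at most n^(k+1) in number, where theta^p = 1/n. *)
Lemma sign_ineq_levels (J : finType) (c t p : R) : 0 <= c -> 0 < t -> 0 < p ->
  sign_ineq X J c -> (0 < #|J|)%N -> expR (- t) `^ p = #|J|%:R^-1 ->
  c * #|J|%:R * expR (- t) ^+ 2 < 1 -> exists2 C : R, 0 <= C &
  (forall m (x : 'I_m -> X), \sum_i `|x i| `^ p = 1 ->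
     mean (fun e : {ffun 'I_m -> bool} => `|\sum_i (-1) ^+ e i *: x i| ^+ 2) <= C).
Proof.
move=> c0 t0 p0 Jc J0 tp; set n := #|J| in J0 tp *; set th := expR (- t) in tp *.
set beta := c * n%:R * th ^+ 2 => beta1.
have th0 : 0 < th by exact: expR_gt0.
have th1 : th < 1 by rewrite expR_lt1 oppr_lt0.
have n0 : 0 < n%:R :> R by rewrite ltr0n.
have beta0 : 0 <= beta.
  by apply: mulr_ge0; [apply: mulr_ge0; rewrite ?ler0n|exact: sqr_ge0].
(* Cauchy-Schwarz with weights g^k needs both the sum of g^k and the sum of (beta / g)^k to be
   bounded: g < 1 and beta <= g^2. Taking the root of beta itself would not do, as it may vanish. *)
pose g := Num.sqrt ((beta + 1) / 2).
have g2 : g ^+ 2 = (beta + 1) / 2 by rewrite sqr_sqrtr // divr_ge0 // addr_ge0.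
have g0 : 0 < g by rewrite sqrtr_gt0 divr_gt0 // ltr_wpDl.
have g1 : g < 1.
  rewrite -[ltRHS]sqrtr1 ltr_sqrt // ltr_pdivrMr // mul1r.
  by move: (beta) beta1 => b; lra.
have bg : beta <= g ^+ 2 by rewrite g2; move: (beta) beta1 => b; lra.
exists ((1 - g)^-1 * (c * n%:R * (1 - g)^-1)).
  by rewrite !mulr_ge0 ?ler0n ?invr_ge0 ?subr_ge0 // ltW.
move=> m x x1.
have xp i : `|x i| `^ p <= 1.
  by rewrite -[leRHS]x1 (bigD1 i) //= lerDl sumr_ge0 // => j _; exact: powR_ge0.
have x_le1 i : `|x i| <= 1.
  rewrite leNgt; apply/negP => xi1; have := xp i.
  rewrite leNgt => /negP; apply; have <- : 1 `^ p = 1 :> R by rewrite powR1.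
  by apply: gt0_ltr_powR; rewrite ?nnegrE.
have lev_ex i : exists k, (x i == 0) || (th ^+ k.+1 < `|x i|).
  have [xi0|xi0] := eqVneq (x i) 0; first by exists 0%N.
  have xi_gt0 : 0 < `|x i| by rewrite normr_gt0.
  have [k kP] := exists_small_power t0 xi_gt0; exists k => /=.
  apply: le_lt_trans kP; rewrite exprS ler_piMl // ?ltW //; exact/exprn_gt0.
pose lev i := ex_minn (lev_ex i).
have levP i : x i != 0 -> th ^+ (lev i).+1 < `|x i| <= th ^+ lev i.
  move=> xi0; rewrite /lev; case: ex_minnP => -[|k] /=.
    by rewrite (negbTE xi0) /= => -> _; rewrite expr0 x_le1.
  rewrite (negbTE xi0) /= => -> min; rewrite leNgt; apply/negP => kx.
  by have := min k; rewrite kx /= ?orbT => /(_ isT); rewrite ltnn.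
pose A k i := (x i != 0) && (lev i == k).
have cardA k : (#|A k| <= n ^ k.+1)%N.
  rewrite -(ler_nat R) natrX.
  have : \sum_(i | A k i) n%:R^-1 ^+ k.+1 <= 1 :> R.
    rewrite -[leRHS]x1 [leRHS](bigID (A k)) /= -[leLHS]addr0 lerD //; last first.
      by apply: sumr_ge0 => i _; exact: powR_ge0.
    apply: ler_sum => i /andP[xi0 /eqP lk]; have /andP[] := levP i xi0.
    rewrite lk => tx _.
    have -> : n%:R^-1 ^+ k.+1 = (th ^+ k.+1) `^ p.
      by rewrite -tp -!powR_mulrn ?powR_ge0 ?ltW // -!powRrM mulrC.
    by apply: ge0_ler_powR; rewrite ?nnegrE ?exprn_ge0 // ltW.
  rewrite sumr_const -[leLHS]mulr_natl exprVn ler_pdivrMr ?exprn_gt0 // mul1r.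
  by apply: le_trans; rewrite ler_nat; apply: eq_leq; apply: eq_card => i.
have meanA k : mean (fun e : {ffun 'I_m -> bool} =>
    `|\sum_(i | A k i) (-1) ^+ e i *: x i| ^+ 2) <= c * n%:R * beta ^+ k.
  have [J' [cJ' HJ']] := sign_ineq_exp k.+1 c0 Jc.
  have J'0 : (0 < #|J'|)%N by rewrite cJ' expn_gt0 J0.
  have AJ' : (#|A k| <= #|J'|)%N by rewrite cJ'.
  have [phi phi_inj] := inj_in_card AJ' J'0.
  apply: le_trans (sign_ineq_sub x HJ' (exprn_ge0 _ c0) phi_inj) _.
  (* At most n^(k+1) vectors of norm at most theta^k, with the constant c^(k+1): the total equals c
     n beta^k. *)
  apply: (@le_trans _ _ (c ^+ k.+1 * (n%:R ^+ k.+1 * (th ^+ k) ^+ 2))); last first.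
    rewrite /beta !exprS !exprMn -!exprM mulnC; apply: eq_le_refl; ring.
  apply: ler_wpM2l; first exact: exprn_ge0.
  apply: (@le_trans _ _ (\sum_(i | A k i) (th ^+ k) ^+ 2)).
    apply: ler_sum => i /andP[xi0 /eqP lk].
    rewrite lerXn2r ?nnegrE ?exprn_ge0 ?(ltW th0) //.
    by have /andP[_] := levP i xi0; rewrite lk.
  rewrite sumr_const -[leLHS]mulr_natl ler_wpM2r ?sqr_ge0 // -natrX ler_nat.
  by apply: leq_trans (cardA k); apply: eq_leq; apply: eq_card => i.
pose K := (\max_i lev i).+1.
have split (e : {ffun 'I_m -> bool}) : \sum_i (-1) ^+ e i *: x i =
    \sum_(k < K) \sum_(i | A k i) (-1) ^+ e i *: x i.
  rewrite (bigID (fun i => x i != 0)) /= [X in _ + X]big1 ?addr0; last first.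
    by move=> i; rewrite negbK => /eqP ->; rewrite scaler0.
  rewrite (partition_big (fun i => inord (lev i) : 'I_K) xpredT) //=.
  apply: eq_bigr => k _; apply: eq_bigl => i; rewrite /A; congr (_ && _).
  by rewrite -(inj_eq val_inj) /= inordK // ltnS leq_bigmax.
pose S k (e : {ffun 'I_m -> bool}) := `|\sum_(i | A k i) (-1) ^+ e i *: x i|.
apply: (@le_trans _ _ (mean (fun e => (\sum_(k < K) g ^+ k) *
     \sum_(k < K) (S k e ^+ 2 / g ^+ k)))).
  apply: mean_le => e; rewrite split.
  apply: le_trans (weighted_cauchy_schwarz K (fun k => S k e) (fun k => exprn_gt0 k g0)).
  rewrite lerXn2r ?nnegrE ?sumr_ge0 // => [k _|]; first exact: normr_ge0.
  exact: ler_norm_sum.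
have gK := geometric_le K (_ : 0 <= g < 1).
rewrite meanZ mean_sum; apply: ler_pM.
- by apply: sumr_ge0 => k _; rewrite exprn_ge0 // ltW.
- apply: sumr_ge0 => k _; rewrite /mean mulr_ge0 ?invr_ge0 ?ler0n // sumr_ge0 // => e _.
  by rewrite divr_ge0 ?sqr_ge0 ?exprn_ge0 // ltW.
- by apply: gK; rewrite ltW.
apply: (@le_trans _ _ (\sum_(k < K) c * n%:R * g ^+ k)); last first.
  by rewrite -mulr_sumr ler_wpM2l ?mulr_ge0 ?ler0n // gK // ltW.
apply: ler_sum => k _.
have -> : mean (fun e => S k e ^+ 2 / g ^+ k) = (g ^+ k)^-1 * mean (fun e => S k e ^+ 2).
  by rewrite -meanZ; apply: eq_mean => e; rewrite mulrC.
rewrite mulrC ler_pdivrMr ?exprn_gt0 //; apply: le_trans (meanA k) _.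
rewrite -[leRHS]mulrA; apply: ler_wpM2l; first by rewrite mulr_ge0 ?ler0n.
rewrite -expr2 -exprM mulnC exprM.
by rewrite lerXn2r ?nnegrE ?sqr_ge0.
Qed.

End TypeFromSigns.

(** * The dichotomy between type and copies of l_1^N *)

Section TrivialType.
Context (R : realType) (X : normedModType R).

(** With [d] strictly between [c] and n = #|J|, put theta^2 = 1 / (d n), so that beta = c / d < 1.
    The relation theta^p = 1 / n then forces p = 2 ln n / (ln d + ln n), which lies between 1 and 2
    because 1 < d < n. *)
Lemma sign_ineq_type (J : finType) (c : R) : 1 <= c < #|J|%:R -> sign_ineq X J c ->
  exists2 p, 1 < p & rademacher_type X p.
Proof.
move=> /andP[c1 cn] Jc; set n := #|J| in cn *.
have c0 : 0 < c by apply: lt_le_trans c1.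
pose d := (c + n%:R) / 2.
have cd : c < d by rewrite /d; lra.
have dn : d < n%:R by rewrite /d; lra.
have d1 : 1 < d by apply: le_lt_trans cd.
have d0 : 0 < d by apply: lt_trans d1.
have n0 : 0 < n%:R :> R by apply: lt_trans dn.
have n1 : 1 < n%:R :> R by apply: lt_trans dn.
have J0 : (0 < #|J|)%N by rewrite -(ltr_nat R).
have lnd : 0 < ln d by exact: ln_gt0.
have lndn : ln d < ln n%:R by rewrite ltr_ln ?posrE.
pose t := (ln d + ln n%:R) / 2.
have t0 : 0 < t by rewrite /t; lra.
have th2 : expR (- t) ^+ 2 = (d * n%:R)^-1.
  rewrite -expRM_natl mulrN expRN; congr (_^-1).
  by rewrite /t mulrC divfK ?pnatr_eq0 // expRD !lnK ?posrE.
pose p := ln n%:R / t; exists p.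
  by rewrite /p ltr_pdivlMr // mul1r /t; lra.
have p12 : 1 <= p <= 2.
  by rewrite /p ler_pdivlMr // ler_pdivrMr // mul1r /t; apply/andP; split; lra.
have p0 : 0 < p by case/andP: p12 => p1 _; apply: lt_le_trans p1.
have tp : expR (- t) `^ p = n%:R^-1.
  by rewrite -expRM /p mulNr mulrC divfK ?gt_eqF // expRN lnK ?posrE.
have beta : c * n%:R * expR (- t) ^+ 2 < 1.
  rewrite th2 invfM mulrACA mulfV ?gt_eqF // mulr1 ltr_pdivrMr // mul1r.
  exact: cd.
have [C C0 HC] := sign_ineq_levels (ltW c0) t0 p0 Jc J0 tp beta.
exact: rademacher_type_normalized p12 C0 HC.
Qed.

Definition l1_copy n (x : 'I_n -> X) := (forall i, `|x i| <= 1) /\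
  forall a : 'I_n -> R, \sum_i `|a i| <= 2 * `|\sum_i a i *: x i|.

Lemma l1_copy_restrict n k (x : 'I_(n + k) -> X) : l1_copy x ->
  l1_copy (fun i : 'I_n => x (lshift k i)).
Proof.
move=> [x1 xa]; split=> // a.
have sl (i : 'I_n) : fintype.split (lshift k i) = inl i := unsplitK (inl i).
have sr (i : 'I_k) : fintype.split (rshift n i) = inr i := unsplitK (inr i).
pose c (i : 'I_(n + k)) := if fintype.split i is inl j then a j else 0.
have -> : \sum_i `|a i| = \sum_i `|c i|.
  rewrite big_split_ord /= [X in _ + X]big1 ?addr0 => [|i _].
    by apply: eq_bigr => i _; rewrite /c sl.
  by rewrite /c sr normr0.
have -> : \sum_i a i *: x (lshift k i) = \sum_i c i *: x i.
  rewrite big_split_ord /= [X in _ + X]big1 ?addr0 => [|i _].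
    by apply: eq_bigr => i _; rewrite /c sl.
  by rewrite /c sr scale0r.
exact: xa.
Qed.

Lemma sign_of_real (b : R) : `|b| <= 1 -> `|(-1) ^+ (b < 0)%R - b| = 1 - `|b|.
Proof.
case: ltP => b0 b1; rewrite ?expr1 ?expr0.
  rewrite ltr0_norm // in b1 *; rewrite ler0_norm; lra.
by rewrite ger0_norm // in b1 *; rewrite ger0_norm; lra.
Qed.

(** Scale the coefficients so that the largest modulus is 1; their moduli then sum to some S >= 1.
    Rounding each to its sign costs N - S in norm, and the combination itself is below S / 2, which
    leaves less than N - S / 2. *)
Lemma small_signed_sum N (x : 'I_N -> X) (a : 'I_N -> R) : (forall i, `|x i| <= 1) ->
  2 * `|\sum_i a i *: x i| < \sum_i `|a i| ->
  exists e : {ffun 'I_N -> bool}, `|\sum_i (-1) ^+ e i *: x i| <= N%:R - 2^-1.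
Proof.
move=> x1 xa.
have A0 : 0 < \sum_i `|a i| by apply: le_lt_trans xa; rewrite mulr_ge0.
have [i0 i0P] : exists i0, a i0 != 0.
  apply/existsP; apply: contraTT A0; rewrite negb_exists => /forallP H.
  rewrite big1 ?ltxx // => i _; have := H i; rewrite negbK => /eqP ->.
  by rewrite normr0.
pose i1 := [arg max_(i > i0) `|a i|]%O; pose M := `|a i1|.
have aM i : `|a i| <= M by rewrite /M /i1; case: arg_maxP => // k _; apply.
have M0 : 0 < M by apply: lt_le_trans (aM i0); rewrite normr_gt0.
pose b (i : 'I_N) : R := a i / M.
have bE i : `|b i| = `|a i| / M by rewrite normrM normfV normr_id.
have b1 i : `|b i| <= 1 by rewrite bE ler_pdivrMr // mul1r.
have Sb : 1 <= \sum_i `|b i|.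
  rewrite (bigD1 i1) //= bE -/M divff ?gt_eqF // lerDl; exact: sumr_ge0.
have xb : 2 * `|\sum_i b i *: x i| < \sum_i `|b i|.
  have -> : \sum_i b i *: x i = M^-1 *: \sum_i a i *: x i.
    by rewrite scaler_sumr; apply: eq_bigr => i _; rewrite scalerA mulrC.
  under [ltRHS]eq_bigr do rewrite bE.
  rewrite -mulr_suml normrZ ger0_norm ?invr_ge0 ?(ltW M0) //.
  by rewrite mulrCA mulrC ltr_pM2r ?invr_gt0.
pose e : {ffun 'I_N -> bool} := [ffun i => b i < 0]; exists e.
have -> : \sum_i (-1) ^+ e i *: x i =
    \sum_i b i *: x i + \sum_i ((-1) ^+ (b i < 0)%R - b i) *: x i.
  by rewrite -big_split; apply: eq_bigr => i _ /=; rewrite ffunE -scalerDl addrC subrK.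
apply: le_trans (ler_normD _ _) _.
have : `|\sum_i ((-1) ^+ (b i < 0)%R - b i) *: x i| <= N%:R - \sum_i `|b i|.
  apply: le_trans (ler_norm_sum _ _ _) _.
  rewrite -[N in N%:R]card_ord -sum1_card natr_sum -sumrB; apply: ler_sum => i _.
  by rewrite normrZ sign_of_real // ler_piMr // subr_ge0.
lra.
Qed.

(** Two sources of gain over the bound N Q, with m and M the smallest and largest norms. Some choice
    of signs, of probability q = 2^-N, falls short of the triangle inequality by m / 2 and gains q
    m^2 / 4. Unequal norms leave at least (M - m)^2 / 2 in Cauchy-Schwarz. Together they are at
    least q M^2 / 8, and N Q <= N^2 M^2 makes this at least [kap] N Q. *)
Lemma sign_ineq_of_no_l1 N : (1 < N)%N -> (forall x : 'I_N -> X, ~ l1_copy x) ->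
  exists2 c : R, 1 <= c < N%:R & sign_ineq X 'I_N c.
Proof.
move=> N1 no; have N0 : 0 < N%:R :> R by rewrite ltr0n ltnW.
have unit_sign (u : 'I_N -> X) : (forall i, `|u i| <= 1) ->
    exists e : {ffun 'I_N -> bool}, `|\sum_i (-1) ^+ e i *: u i| <= N%:R - 2^-1.
  move=> u1; apply: contrapT => nex; apply: (no u); split=> // a.
  rewrite leNgt; apply/negP => ua; apply: nex; exact: small_signed_sum u1 ua.
pose q : R := 2 ^- N.
have q0 : 0 < q by rewrite invr_gt0 exprn_gt0.
have q1 : q <= 1 by rewrite invf_le1 ?exprn_gt0 // exprn_ege1 // ler1n.
pose kap := q / (8 * N%:R ^+ 2).
have kap0 : 0 < kap by rewrite divr_gt0 // mulr_gt0 // exprn_gt0.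
have N2 : 2 <= N%:R :> R by rewrite ler_nat.
have kapN : kap * N%:R <= 1.
  rewrite /kap mulrAC ler_pdivrMr ?mulr_gt0 ?exprn_gt0 // mul1r.
  rewrite expr2 mulrA ler_wpM2r ?(ltW N0) //; lra.
exists (N%:R * (1 - kap)).
  rewrite mulrBr mulr1 [_ * kap]mulrC; apply/andP; split; first by lra.
  by rewrite gtrBl mulr_gt0.
move=> x; pose a (i : 'I_N) : R := `|x i|.
have j0 : 'I_N by exact: (Ordinal (ltnW N1)).
pose i0 := [arg min_(i < j0) a i]%O; pose i1 := [arg max_(i > j0) a i]%O.
have am i : a i0 <= a i by rewrite /i0; case: arg_minP => // k _; apply.
have aM i : a i <= a i1 by rewrite /i1; case: arg_maxP => // k _; apply.
set m := a i0 in am *; set M := a i1 in aM *.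
have m0 : 0 <= m by exact: normr_ge0.
set A := \sum_i a i; set Q := \sum_i a i ^+ 2.
have mA : m <= A.
  by rewrite /A (bigD1 i0) //= lerDl; apply: sumr_ge0 => i _; exact: normr_ge0.
(* Each [x i] is split as m u_i + (a_i - m) u_i with u_i of norm 1: the good signs for the u_i help
   the first part, and the triangle inequality bounds the second. If m = 0 there is nothing to gain
   and any signs do. *)
have [e0 e0P] : exists e : {ffun 'I_N -> bool},
    `|\sum_i (-1) ^+ e i *: x i| <= A - m / 2.
  have [mz|mnz] := eqVneq m 0.
    exists [ffun=> false]; rewrite mz mul0r subr0; apply: le_trans (ler_norm_sum _ _ _) _.
    by apply: ler_sum => i _; rewrite normrZ normrX normrN1 expr1n mul1r.
  have m_gt0 : 0 < m by rewrite lt_neqAle eq_sym mnz.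
  have a_gt0 i : 0 < a i by apply: lt_le_trans (am i).
  pose u i := (a i)^-1 *: x i.
  have u1 i : `|u i| = 1.
    by rewrite normrZ ger0_norm ?invr_ge0 ?(ltW (a_gt0 i)) // mulVf ?gt_eqF.
  have [e eP] := unit_sign u (fun i => eq_le_refl (u1 i)); exists e.
  have -> : \sum_i (-1) ^+ e i *: x i = m *: (\sum_i (-1) ^+ e i *: u i) +
      \sum_i ((-1) ^+ e i * (a i - m)) *: u i.
    rewrite scaler_sumr -big_split; apply: eq_bigr => i _ /=.
    rewrite scalerA -scalerDl /u scalerA; congr (_ *: _).
    by field; rewrite gt_eqF.
  apply: le_trans (ler_normD _ _) _.
  have B1 : `|m *: \sum_i (-1) ^+ e i *: u i| <= m * (N%:R - 2^-1).
    by rewrite normrZ ger0_norm // ler_wpM2l.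
  have B2 : `|\sum_i ((-1) ^+ e i * (a i - m)) *: u i| <= A - m * N%:R.
    apply: le_trans (ler_norm_sum _ _ _) _.
    rewrite -[N in N%:R]card_ord -sum1_card natr_sum mulr_sumr /A -sumrB.
    apply: ler_sum => i _; rewrite normrZ u1 !mulr1 normrM normrX normrN1 expr1n mul1r.
    by rewrite ger0_norm // subr_ge0.
  by apply: le_trans (lerD B1 B2) _; rewrite mulrBr; lra.
have mean_bound : mean (fun e : {ffun 'I_N -> bool} =>
    `|\sum_i (-1) ^+ e i *: x i| ^+ 2) <= A ^+ 2 - q * (m ^+ 2 / 4).
  have pt (e : {ffun 'I_N -> bool}) : `|\sum_i (-1) ^+ e i *: x i| ^+ 2
      <= A ^+ 2 - (e == e0)%:R * (m ^+ 2 / 4).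
    have nA : `|\sum_i (-1) ^+ e i *: x i| <= A.
      apply: le_trans (ler_norm_sum _ _ _) _.
      by apply: ler_sum => i _; rewrite normrZ normrX normrN1 expr1n mul1r.
    have [->|_] := eqVneq e e0; last first.
      by rewrite mul0r subr0 lerXn2r ?nnegrE // (le_trans _ mA).
    rewrite mul1r; apply: (@le_trans _ _ ((A - m / 2) ^+ 2)).
      by rewrite lerXn2r ?nnegrE // (le_trans _ e0P).
    have sq (b B : R) : b * b <= B * b -> (B - b / 2) ^+ 2 <= B ^+ 2 - b ^+ 2 / 4.
      have -> : (B - b / 2) ^+ 2 = B ^+ 2 - B * b + b * b / 4 by field.
      by have := sqr_ge0 b; rewrite (expr2 b); lra.
    by apply: sq; rewrite ler_wpM2r.
  apply: le_trans (mean_le pt) _.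
  rewrite (eq_mean (h := fun e => A ^+ 2 + - (m ^+ 2 / 4) * (e == e0)%:R)); last first.
    by move=> e; rewrite mulNr mulrC.
  rewrite meanD mean_cst ?card_cube_gt0 // meanZ /mean (bigD1 e0) //= eqxx.
  rewrite big1 ?addr0 => [|e /negbTE -> //].
  by rewrite mulr1 card_cube card_ord natrX mulNr mulrC.
have var : (M - m) ^+ 2 <= 2 * (N%:R * Q - A ^+ 2).
  have -> : 2 * (N%:R * Q - A ^+ 2) = \sum_i \sum_j (a i - a j) ^+ 2.
    have -> : \sum_i \sum_j (a i - a j) ^+ 2 =
       \sum_i (N%:R * a i ^+ 2 - 2 * (a i * A) + Q).
      apply: eq_bigr => i _; rewrite /Q -[N in N%:R]card_ord -sum1_card natr_sum.
      rewrite mulr_suml /A !mulr_sumr -sumrB -big_split /=; apply: eq_bigr => j _.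
      by ring.
    rewrite big_split /= sumrB sumr_const card_ord -!mulr_sumr -mulr_suml -/A -/Q.
    by rewrite -[Q *+ N]mulr_natl; ring.
  rewrite (bigD1 i1) //= (bigD1 i0) //= -/m -/M -addrA lerDl addr_ge0 //.
    by apply: sumr_ge0 => j _; exact: sqr_ge0.
  by apply: sumr_ge0 => i _; apply: sumr_ge0 => j _; exact: sqr_ge0.
have QM : N%:R * Q <= N%:R ^+ 2 * M ^+ 2.
  rewrite expr2 -mulrA; apply: ler_wpM2l; first exact: ltW.
  rewrite -[N in leRHS]card_ord -sum1_card natr_sum mulr_suml; apply: ler_sum => i _.
  by rewrite mul1r lerXn2r ?nnegrE //; exact: normr_ge0.
apply: (le_trans mean_bound).
have -> : N%:R * (1 - kap) * \sum_j `|x j| ^+ 2 = N%:R * Q - kap * (N%:R * Q).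
  by rewrite /Q /a; ring.
have kQ : kap * (N%:R * Q) <= q / 8 * M ^+ 2.
  apply: (@le_trans _ _ (kap * (N%:R ^+ 2 * M ^+ 2))).
    by apply: ler_wpM2l => //; exact: ltW.
  by apply: eq_le_refl; rewrite /kap; field; rewrite gt_eqF.
have MM : M ^+ 2 <= 2 * (m ^+ 2 + (M - m) ^+ 2).
  rewrite -subr_ge0.
  have -> : 2 * (m ^+ 2 + (M - m) ^+ 2) - M ^+ 2 = (M - 2 * m) ^+ 2 by ring.
  exact: sqr_ge0.
have qM : q / 8 * M ^+ 2 <= q / 4 * (m ^+ 2 + (M - m) ^+ 2).
  have -> : q / 4 * (m ^+ 2 + (M - m) ^+ 2) = q / 8 * (2 * (m ^+ 2 + (M - m) ^+ 2)).
    by field.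
  by apply: ler_wpM2l => //; rewrite divr_ge0 // ltW.
have qD : q / 4 * (M - m) ^+ 2 <= (M - m) ^+ 2 / 4.
  by rewrite mulrAC ler_wpM2r ?invr_ge0 // ler_piMl ?sqr_ge0.
have D0 := sqr_ge0 (M - m).
move: var kQ qM qD D0; rewrite [q / 4 * (_ + _)]mulrDr.
move: ((M - m) ^+ 2) (m ^+ 2) (M ^+ 2) (A ^+ 2) (N%:R * Q) => D m2 M2 A2 NQ.
move: (kap * NQ) (q / 8 * M2) => k1 k2.
have -> : q * (m2 / 4) = q / 4 * m2 by ring.
move: (q / 4 * m2) (q / 4 * D) => k3 k4; lra.
Qed.

Lemma trivial_type_l1_copy : trivial_rademacher_type X ->
  forall n, exists x : 'I_n -> X, l1_copy x.
Proof.
move=> triv n; apply: contrapT => none.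
(* Two vectors are added so that the dichotomy, which needs more than one vector, applies for every
   [n]. *)
have none2 (x : 'I_(n + 2) -> X) : ~ l1_copy x.
  by move=> /l1_copy_restrict H; apply: none; exists (fun i => x (lshift 2 i)).
have n2 : (1 < n + 2)%N by rewrite addn2.
have [c cN Jc] := sign_ineq_of_no_l1 n2 none2.
have cN' : 1 <= c < #|'I_(n + 2)|%:R by rewrite card_ord.
by have [p p1 /(triv p p1)] := sign_ineq_type cN' Jc.
Qed.

End TrivialType.

(** * The characterization *)

Section Distortion.
Context (R : realType) (X : normedModType R).

Lemma l1_copy_embedding (c D : R) n : 0 <= c ->
  (forall k, exists x : 'I_k -> X, l1_copy x) ->
  (forall p q : 'S_n.+1, (word_dist p q)%:R <=
     c * \sum_k `|l1_map R p k - l1_map R q k| <= D * (word_dist p q)%:R) ->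
  exists f : SymS R n -> X, forall p q : SymS R n,
    mdist p q <= `|f p - f q| <= 2 * D * mdist p q.
Proof.
move=> c0 copies l1P; have [x [x1 xa]] := copies #|l1_index n|.
pose s (p : 'S_n.+1) := \sum_i l1_map R p (enum_val i) *: x i.
exists (fun p => (2 * c) *: s p) => p q.
have E : s p - s q = \sum_i (l1_map R p (enum_val i) - l1_map R q (enum_val i)) *: x i.
  by rewrite -sumrB; apply: eq_bigr => i _; rewrite scalerBl.
have reidx : \sum_k `|l1_map R p k - l1_map R q k| =
    \sum_(i < #|l1_index n|) `|l1_map R p (enum_val i) - l1_map R q (enum_val i)|.
  by rewrite (reindex _ (onW_bij _ (enum_val_bij _))).
have /andP[lo hi] := l1P p q.
rewrite reidx in lo hi; rewrite mdist_SymS -scalerBr normrZ ger0_norm ?mulr_ge0 // E.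
have up : `|\sum_i (l1_map R p (enum_val i) - l1_map R q (enum_val i)) *: x i| <=
   \sum_(i < #|l1_index n|) `|l1_map R p (enum_val i) - l1_map R q (enum_val i)|.
  apply: le_trans (ler_norm_sum _ _ _) _; apply: ler_sum => i _.
  by rewrite normrZ ler_piMr.
have := xa (fun i => l1_map R p (enum_val i) - l1_map R q (enum_val i)).
move: lo hi up; move: (\sum_i `|_|) (`|_|) (word_dist p q)%:R => a b d lo hi up low.
have cu := ler_wpM2l c0 up; have cl := ler_wpM2l c0 low.
apply/andP; split.
  by apply: (le_trans lo); apply: (le_trans cl); rewrite mulrCA mulrA.
rewrite -!mulrA ler_pM2l //; exact: le_trans cu hi.
Qed.

(** Dividing by rho^K with rho = 2^(1/p) < 2 leaves an exponential (2 / rho)^K bounded by a linear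
    function of K. *)
Lemma exp_dominates (p c A : R) : 1 < p -> 0 <= c -> 0 <= A ->
  ~ forall K, (2 ^ K)%:R <= c * (1 + 4 * (K%:R * (A * (2 ^ K)%:R `^ p^-1))).
Proof.
move=> p1 c0 A0 H; have p0 : 0 < p by apply: lt_trans p1.
pose rho : R := 2 `^ p^-1.
have rho1 : 1 <= rho.
  have <- : 2 `^ 0 = 1 :> R by rewrite powRr0.
  by apply: ler_powR; rewrite ?ler1n ?invr_ge0 ?(ltW p0).
have rho2 : rho < 2.
  have l2 : 0 < ln 2 :> R by rewrite ln_gt0 // ltr1n.
  rewrite /rho /powR gt_eqF // -[ltRHS]lnK ?posrE // ltr_expR.
  by rewrite -[ltRHS]mul1r ltr_pM2r // invf_lt1.
have rho0 : 0 < rho by apply: lt_le_trans rho1.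
have rhoK K : (2 ^ K)%:R `^ p^-1 = rho ^+ K.
  rewrite natrX -(powR_mulrn K (ler0n R 2)) -(powR_mulrn K (powR_ge0 _ _)).
  by rewrite -(powRrM 2 K%:R) -(powRrM 2 p^-1) mulrC.
pose c' := c * (1 + 4 * A); have c'0 : 0 <= c' by rewrite mulr_ge0 ?addr_ge0 ?mulr_ge0.
pose del := 2 / rho - 1.
have del0 : 0 < del by rewrite subr_gt0 ltr_pdivlMr // mul1r.
have growth K : (1 + del) ^+ K <= c' * K.+1%:R.
  have rK0 : 0 < rho ^+ K by exact: exprn_gt0.
  rewrite /del addrC subrK expr_div_n ler_pdivrMr //.
  have := H K; rewrite rhoK natrX => /le_trans; apply.
  rewrite /c' -!mulrA; apply: ler_wpM2l => //.
  have rK1 : 1 <= rho ^+ K by exact: exprn_ege1.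
  have K0 : 0 <= K%:R :> R by exact: ler0n.
  rewrite -[K.+1%:R]natr1; move: (K%:R) K0 (rho ^+ K) rK0 rK1 => k k0 y y0 y1.
  have -> : (1 + 4 * A) * ((k + 1) * y) =
    1 + 4 * (k * (A * y)) + ((y - 1) + k * y + 4 * (A * y)) by ring.
  have y0' := ltW y0; have := mulr_ge0 k0 y0'; have := mulr_ge0 A0 y0'.
  by move: (A * y) (k * y) => u v u0 v0; rewrite lerDl; lra.
have bern k : k%:R * del <= (1 + del) ^+ k.
  elim: k => [|k IH]; first by rewrite mul0r expr0.
  have ge1 : 1 <= (1 + del) ^+ k by apply: exprn_ege1; rewrite lerDl ltW.
  rewrite -[k.+1%:R]natr1 mulrDl mul1r exprS mulrDl mul1r; apply: lerD => //.
  by rewrite ler_peMr // ltW.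
have [k k_gt0 kP] : exists2 k, (0 < k)%N & 3 * c' / del ^+ 2 < k%:R.
  exists (Num.bound (3 * c' / del ^+ 2)).+1 => //.
  apply: lt_le_trans (archi_boundP _) _; last by rewrite ler_nat leqnSn.
  by rewrite divr_ge0 ?sqr_ge0 // mulr_ge0.
have k0 : 0 < k%:R :> R by rewrite ltr0n.
(* A single Bernoulli bound is only linear and gives no contradiction; at the exponent 2 k its
   square is quadratic in k. *)
have sq : (k%:R * del) ^+ 2 <= c' * (3 * k%:R).
  apply: (@le_trans _ _ (((1 + del) ^+ k) ^+ 2)).
    have kd0 : 0 <= k%:R * del by rewrite mulr_ge0 // ltW.
    have ge0 := le_trans kd0 (bern k).
    by apply: lerXn2r; rewrite ?nnegrE // bern.
  rewrite -exprM; apply: le_trans (growth _) _; apply: ler_wpM2l => //.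
  by rewrite -natrM ler_nat; lia.
move: kP; rewrite ltr_pdivrMr ?exprn_gt0 // ltNge => /negP; apply.
rewrite -(ler_pM2l k0); move: sq; rewrite exprMn !expr2; lra.
Qed.

Lemma not_type_of_embeddings (r p : R) : 1 < p ->
  (forall n, exists2 D, 1 < D < r & exists f : SymS R n -> X, forall x y : SymS R n,
    mdist x y <= `|f x - f y| <= D * mdist x y) -> ~ rademacher_type X p.
Proof.
move=> p1 emb /type_cube_bound[A A0 HA].
have r0 : 0 < r by have [D /andP[D1 Dr] _] := emb 0%N; lra.
(* 560 = 14 * 40: edges have length at most 14 m, antipodal points are at distance at least m^2 /
   40, and one factor m cancels. *)
have c0 : 0 <= 560 * r by apply: mulr_ge0; [exact: ler0n|exact: ltW].
apply: (exp_dominates p1 c0 A0) => K.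
have m0 : 0 < (2 ^ K)%:R :> R by rewrite ltr0n expn_gt0.
have [D /andP[D1 Dr] [f fP]] := emb (4 * 2 ^ K)%N.
have D0 : 0 <= D by lra.
pose g (x : {ffun 'I_(2 ^ K) -> bool}) := f (cube_perm x).
have L0 : 0 < 14 * r * (2 ^ K)%:R by rewrite !mulr_gt0 // ltr0n.
have e x j : `|g x - g (flip j x)| <= 14 * r * (2 ^ K)%:R.
  have /andP[_ up] := fP (cube_perm x) (cube_perm (flip j x)).
  apply: (le_trans up); rewrite mdist_SymS.
  have le : (word_dist (cube_perm x) (cube_perm (flip j x)) <= 14 * 2 ^ K)%N.
    by apply: (@cube_perm_edge _ _ _ j) => k /negbTE kj; rewrite ffunE kj addbF.
  apply: (@le_trans _ _ (D * (14 * (2 ^ K)%:R))).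
    by apply: ler_wpM2l => //; rewrite -natrM ler_nat.
  have -> : 14 * r * (2 ^ K)%:R = r * (14 * (2 ^ K)%:R) by ring.
  by apply: ler_wpM2r; [apply: mulr_ge0; rewrite ler0n|exact: ltW].
have a x : (2 ^ K)%:R ^+ 2 / 40 <= `|g x - g (negf x)|.
  have /andP[lo _] := fP (cube_perm x) (cube_perm (negf x)).
  apply: le_trans lo; rewrite mdist_SymS ler_pdivrMr ?ltr0n //.
  rewrite mulrC -natrX -natrM ler_nat.
  by apply: cube_perm_antipodal => j; rewrite ffunE.
have := HA K g _ _ L0 e a; rewrite ler_pdivrMr ?ltr0n //.
set Y := 1 + _; move: ((2 ^ K)%:R) m0 Y => m m0 Y H.
rewrite -(ler_pM2l m0); apply: le_trans (_ : 14 * r * m * Y * 40 <= _).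
  by rewrite -expr2.
apply: eq_le_refl; ring.
Qed.

End Distortion.

Theorem proposition1 (R : realType) (X : completeNormedModType R) :
  trivial_rademacher_type X <->
  (ereal_sup (range (fun n : nat => distortion X (SymS R n))) < +oo)%E.
Proof.
split=> [triv|].
  have [c [D [c0 D1 l1P]]] := l1_map_bilipschitz R.
  apply: (@le_lt_trans _ _ ((2 * D)%:E)%E); last exact: ltry.
  apply: ge_ereal_sup => _ [n _ <-]; apply: ereal_inf_lbound.
  exists (2 * D) => //; split; first lra.
  exact: l1_copy_embedding c0 (trivial_type_l1_copy triv) (l1P n).
(* The infima defining the distortions need not be attained; a number [r] strictly above their
   supremum yields, for every [n], an actual embedding with constant below [r]. *)
move=> fin p p1; have [r sr] : exists r : R, (ereal_sup (range (fun n : nat =>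
    distortion X (SymS R n))) < r%:E)%E.
  case: (ereal_sup _) fin => [s _||_] //; last by exists 0; rewrite ltNyr.
  by exists (s + 1); rewrite lte_fin ltrDl.
apply: (@not_type_of_embeddings _ _ r) => // n.
have : (distortion X (SymS R n) < r%:E)%E.
  by apply: le_lt_trans sr; apply: ereal_sup_ubound; exists n.
move=> /ereal_inf_lt[_ [D [D1 emb] <-] Dr]; exists D => //.
by rewrite D1 -lte_fin.
Qed.
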